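(* Let $\gamma\in\mathbb C$, $h=h_{13}+\gamma h_\perp\in\mathfrak{sl}(3)$, and $\sigma=\ln(1+\xi e_{13})\in U(\mathfrak{sl}(3))[[\xi]]$, where $\xi$ is a formal parameter. The element $$\mathcal F(\gamma)=\exp\!\Big(\xi\,e_{12}\otimes e_{23}\,e^{\frac12(3\gamma-1)\sigma}\Big)\exp(h\otimes\sigma)$$ is a solution of the twist equations for $U(\mathfrak{sl}(3))[[\xi]]$. Put $$h^{\#}=h,\quad h_\perp^{\#}=h_\perp,\quad e_{12}^{\#}=e_{12},\quad e_{21}^{\#}=e_{21},\quad e_{13}^{\#}=\sigma,\quad e_{23}^{\#}=e_{23}e^{-\sigma},\quad e_{32}^{\#}=e_{32}-\xi\,h\,e_{12},\quad e_{31}^{\#}=e_{31}-\xi\,h^2 .$$ Then in the twisted Hopf algebra $U_{\mathcal F}(\mathfrak{sl}(3))$, with $\Delta_{\mathcal F}(\cdot)=\mathcal F(\gamma)\Delta(\cdot)\mathcal F(\gamma)^{-1}$, the coproducts of these elements are $$\begin{aligned} \Delta_{\mathcal F}(h^{\#})&=h^{\#}\otimes e^{-e_{13}^{\#}}+1\otimes h^{\#}-\xi\,e_{12}^{\#}\otimes e_{23}^{\#}e^{\frac12(3\gamma-1)e_{13}^{\#}},\\ \Delta_{\mathcal F}(e_{13}^{\#})&=e_{13}^{\#}\otimes1+1\otimes e_{13}^{\#},\\ \Delta_{\mathcal F}(e_{12}^{\#})&=e_{12}^{\#}\otimes e^{\frac12(3\gamma-1)e_{13}^{\#}}+1\otimes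 e_{12}^{\#},\\ \Delta_{\mathcal F}(e_{23}^{\#})&=e_{23}^{\#}\otimes e^{-\frac12(3\gamma+1)e_{13}^{\#}}+1\otimes e_{23}^{\#},\\ \Delta_{\mathcal F}(h_\perp^{\#})&=h_\perp^{\#}\otimes1+1\otimes h_\perp^{\#},\\ \Delta_{\mathcal F}(e_{21}^{\#})&=e_{21}^{\#}\otimes e^{-\frac12(3\gamma+1)e_{13}^{\#}}+1\otimes e_{21}^{\#}+\xi(1-\gamma)\,h_\perp^{\#}\otimes e_{23}^{\#},\\ \Delta_{\mathcal F}(e_{32}^{\#})&=e_{32}^{\#}\otimes e^{\frac12(3\gamma-1)e_{13}^{\#}}+1\otimes e_{32}^{\#}-\xi(\gamma+1)\,e_{12}^{\#}\otimes h_\perp^{\#}e^{\frac12(3\gamma-1)e_{13}^{\#}},\\ \Delta_{\mathcal F}(e_{31}^{\#})&=e_{31}^{\#}\otimes e^{-e_{13}^{\#}}+1\otimes e_{31}^{\#}+\xi\,e_{12}^{\#}\otimes e_{21}^{\#}e^{\frac12(3\gamma-1)e_{13}^{\#}}-\xi\,e_{32}^{\#}\otimes e_{23}^{\#}e^{\frac12(3\gamma-1)e_{13}^{\#}}\\ &\quad-2\xi\gamma\,h^{\#}\otimes h_\perp^{\#}e^{-e_{13}^{\#}}+2\xi^2\gamma\,e_{12}^{\#}\otimes h_\perp^{\#}e_{23}^{\#}e^{\frac12(3\gamma-1)e_{13}^{\#}}. \end{aligned}$$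
   Context: $\mathfrak{sl}(3)$ is the complex Lie algebra of traceless $3\times3$ matrices; $e_{ab}$ are the matrix units, $h_{13}=\frac12(e_{11}-e_{33})$, $h_\perp=\frac12(e_{11}-2e_{22}+e_{33})$. $U(\mathfrak{sl}(3))$ has its usual Hopf structure with primitive generators, coproduct $\Delta$ and counit $\epsilon$; everything is extended to formal power series in $\xi$ with $\xi$-adically completed tensor products. Products such as $h\,e_{12}$ and $h_\perp^{\#}e_{23}^{\#}$ are products in $U(\mathfrak{sl}(3))[[\xi]]$, in the order written. A solution of the twist equations is an invertible element $\mathcal F$ of the completed tensor square with $\mathcal F_{12}(\Delta\otimes\mathrm{id})(\mathcal F)=\mathcal F_{23}(\mathrm{id}\otimes\Delta)(\mathcal F)$ and $(\epsilon\otimes\mathrm{id})(\mathcal F)=(\mathrm{id}\otimes\epsilon)(\mathcal F)=1$. The twisted Hopf algebra $U_{\mathcal F}$ has the same multiplication, unit and counit and the coproduct $\Delta_{\mathcal F}=\mathcal F\Delta(\cdot)\mathcal F^{-1}$. *)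

(* Defs.v *)
From HB Require Import structures.
From mathcomp Require Import all_boot all_order all_algebra.
From mathcomp Require Import generic_quotient.
From mathcomp Require Import boolp classical_sets.
From mathcomp Require Import ring.

Set Implicit Arguments.
Unset Strict Implicit.
Unset Printing Implicit Defensive.

Import GRing.Theory.
Local Open Scope ring_scope.
Local Open Scope quotient_scope.

(* Both the universal enveloping algebra and the tensor product of two algebras
   are quotients of a free associative unital algebra by a two-sided ideal.
   Noncommutative polynomials are represented by the terms below; the congruence
   [alg_cong] is generated by the axioms of unital associative K-algebras and
   the given relations, so its quotient is K<X | rel>. *)

Inductive alg_term (K X : Type) : Type :=
| TGen of X
| TZero
| TOne
| TOpp of alg_term K X
| TAdd of alg_term K X & alg_term K X
| TMul of alg_term K X & alg_term K X
| TScale of K & alg_term K X.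

Arguments TGen {K X}.
Arguments TZero {K X}.
Arguments TOne {K X}.

Fixpoint alg_eval (K : comNzRingType) (X : Type) (A : algType K) (f : X -> A)
    (t : alg_term K X) : A :=
  match t with
  | TGen x => f x
  | TZero => 0
  | TOne => 1
  | TOpp s => - alg_eval f s
  | TAdd s u => alg_eval f s + alg_eval f u
  | TMul s u => alg_eval f s * alg_eval f u
  | TScale a s => a *: alg_eval f s
  end.

Inductive alg_cong (K : comNzRingType) (X : Type)
    (rel : alg_term K X -> alg_term K X -> Prop) :
    alg_term K X -> alg_term K X -> Prop :=
| CRel s t of rel s t : alg_cong rel s t
| CRefl s : alg_cong rel s s
| CSym s t of alg_cong rel s t : alg_cong rel t s
| CTrans s t u of alg_cong rel s t & alg_cong rel t u : alg_cong rel s u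
| COpp s s' of alg_cong rel s s' : alg_cong rel (TOpp s) (TOpp s')
| CAdd s s' t t' of alg_cong rel s s' & alg_cong rel t t' :
    alg_cong rel (TAdd s t) (TAdd s' t')
| CMul s s' t t' of alg_cong rel s s' & alg_cong rel t t' :
    alg_cong rel (TMul s t) (TMul s' t')
| CScale a s s' of alg_cong rel s s' :
    alg_cong rel (TScale a s) (TScale a s')
| CAddA s t u : alg_cong rel (TAdd s (TAdd t u)) (TAdd (TAdd s t) u)
| CAddC s t : alg_cong rel (TAdd s t) (TAdd t s)
| CAdd0 s : alg_cong rel (TAdd TZero s) s
| CAddN s : alg_cong rel (TAdd (TOpp s) s) TZero
| CMulA s t u : alg_cong rel (TMul s (TMul t u)) (TMul (TMul s t) u)
| CMul1l s : alg_cong rel (TMul TOne s) s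
| CMul1r s : alg_cong rel (TMul s TOne) s
| CMulDl s t u :
    alg_cong rel (TMul (TAdd s t) u) (TAdd (TMul s u) (TMul t u))
| CMulDr s t u :
    alg_cong rel (TMul s (TAdd t u)) (TAdd (TMul s t) (TMul s u))
| CScaleA a b s :
    alg_cong rel (TScale a (TScale b s)) (TScale (a * b) s)
| CScale1 s : alg_cong rel (TScale 1 s) s
| CScaleDr a s t :
    alg_cong rel (TScale a (TAdd s t)) (TAdd (TScale a s) (TScale a t))
| CScaleDl a b s :
    alg_cong rel (TScale (a + b) s) (TAdd (TScale a s) (TScale b s))
| CScaleAl a s t : alg_cong rel (TScale a (TMul s t)) (TMul (TScale a s) t)
| CScaleAr a s t : alg_cong rel (TScale a (TMul s t)) (TMul s (TScale a t)).

Definition respects (K : comNzRingType) (X : Type)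
    (rel : alg_term K X -> alg_term K X -> Prop) (A : algType K) (f : X -> A) :=
  forall s t, rel s t -> alg_eval f s = alg_eval f t.

Lemma alg_eval_cong (K : comNzRingType) (X : Type)
    (rel : alg_term K X -> alg_term K X -> Prop) (A : algType K) (f : X -> A) :
  respects rel f ->
  forall s t, alg_cong rel s t -> alg_eval f s = alg_eval f t.
Proof.
move=> fP s t; elim=> //=.
- by move=> ? ? ? _ -> _ ->.
- by move=> ? ? _ ->.
- by move=> ? ? ? ? _ -> _ ->.
- by move=> ? ? ? ? _ -> _ ->.
- by move=> ? ? ? _ ->.
- by move=> *; rewrite addrA.
- by move=> *; rewrite addrC.
- by move=> *; rewrite add0r.
- by move=> *; rewrite addNr.
- by move=> *; rewrite mulrA.
- by move=> *; rewrite mul1r.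
- by move=> *; rewrite mulr1.
- by move=> *; rewrite mulrDl.
- by move=> *; rewrite mulrDr.
- by move=> *; rewrite scalerA.
- by move=> *; rewrite scale1r.
- by move=> *; rewrite scalerDr.
- by move=> *; rewrite scalerDl.
- by move=> *; rewrite scalerAl.
- by move=> *; rewrite scalerAr.
Qed.

(* Algebras with a character (augmentation).  The only purpose of the
   augmentation is to witness 1 != 0, which the library requires of an
   [algType] and which can fail for an algebra given by a presentation; it does
   not affect the underlying algebra.  For an enveloping algebra it is the
   counit. *)
HB.mixin Record hasAugmentation (K : comNzRingType) A of GRing.Algebra K A := {
  augm_subdef : {lrmorphism A -> K^o}
}.

#[short(type="augAlgType")]
HB.structure Definition AugAlgebra (K : comNzRingType) :=
  {A of GRing.Algebra K A & hasAugmentation K A}.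

Definition augm (K : comNzRingType) (A : augAlgType K) : {lrmorphism A -> K^o} :=
  augm_subdef.

Record presentation (K : comNzRingType) := Presentation {
  pres_gen : Type;
  pres_rel : alg_term K pres_gen -> alg_term K pres_gen -> Prop;
  pres_aug : pres_gen -> K^o;
  pres_augP : respects pres_rel pres_aug
}.

HB.instance Definition _ (K X : Type) := gen_eqMixin (alg_term K X).
HB.instance Definition _ (K X : Type) := gen_choiceMixin (alg_term K X).

Section PresentedAlgebra.
Variables (K : comNzRingType) (P : presentation K).

Definition pres_cong : rel (alg_term K (pres_gen P)) :=
  fun s t => `[< alg_cong (@pres_rel K P) s t >].

Lemma pres_cong_refl : reflexive pres_cong.
Proof. by move=> s; apply/asboolP/CRefl. Qed.

Lemma pres_cong_sym : symmetric pres_cong.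
Proof. by move=> s t; apply/asboolP/asboolP; apply: CSym. Qed.

Lemma pres_cong_trans : transitive pres_cong.
Proof.
by move=> t s u /asboolP st /asboolP tu; apply/asboolP/(CTrans st tu).
Qed.

Canonical pres_cong_equiv :=
  EquivRel pres_cong pres_cong_refl pres_cong_sym pres_cong_trans.

Definition presAlg := {eq_quot pres_cong}.
HB.instance Definition _ := Choice.on presAlg.
HB.instance Definition _ := EqQuotient.on presAlg.

Implicit Types s t u : alg_term K (pres_gen P).

Definition pres_pi s : presAlg := \pi_presAlg s.

Lemma pres_piP s t : pres_pi s = pres_pi t <-> alg_cong (@pres_rel K P) s t.
Proof.
by split=> [/eqmodP/asboolP //|st]; apply/eqmodP/asboolP.
Qed.

Lemma pres_ind (Q : presAlg -> Prop) :
  (forall s, Q (pres_pi s)) -> forall x, Q x.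
Proof. by move=> QP x; rewrite -[x]reprK; apply: QP. Qed.

Lemma repr_pres_pi s : alg_cong (@pres_rel K P) (repr (pres_pi s)) s.
Proof. by apply/pres_piP; rewrite /pres_pi reprK. Qed.

Definition pres_add (x y : presAlg) := pres_pi (TAdd (repr x) (repr y)).
Definition pres_mul (x y : presAlg) := pres_pi (TMul (repr x) (repr y)).
Definition pres_opp (x : presAlg) := pres_pi (TOpp (repr x)).
Definition pres_scale (a : K) (x : presAlg) := pres_pi (TScale a (repr x)).

Lemma pres_piD s t : pres_add (pres_pi s) (pres_pi t) = pres_pi (TAdd s t).
Proof. by apply/pres_piP/CAdd; apply: repr_pres_pi. Qed.
Lemma pres_piM s t : pres_mul (pres_pi s) (pres_pi t) = pres_pi (TMul s t).
Proof. by apply/pres_piP/CMul; apply: repr_pres_pi. Qed.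
Lemma pres_piN s : pres_opp (pres_pi s) = pres_pi (TOpp s).
Proof. by apply/pres_piP/COpp; apply: repr_pres_pi. Qed.
Lemma pres_piZ a s : pres_scale a (pres_pi s) = pres_pi (TScale a s).
Proof. by apply/pres_piP/CScale; apply: repr_pres_pi. Qed.

Let piE := (pres_piD, pres_piM, pres_piN, pres_piZ).

Lemma pres_addA : associative pres_add.
Proof.
elim/pres_ind=> s; elim/pres_ind=> t; elim/pres_ind=> u; rewrite !piE.
exact/pres_piP/CAddA.
Qed.
Lemma pres_addC : commutative pres_add.
Proof.
by elim/pres_ind=> s; elim/pres_ind=> t; rewrite !piE; apply/pres_piP/CAddC.
Qed.
Lemma pres_add0 : left_id (pres_pi TZero) pres_add.
Proof. by elim/pres_ind=> s; rewrite !piE; apply/pres_piP/CAdd0. Qed.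
Lemma pres_addN : left_inverse (pres_pi TZero) pres_opp pres_add.
Proof. by elim/pres_ind=> s; rewrite !piE; apply/pres_piP/CAddN. Qed.

HB.instance Definition _ :=
  GRing.isZmodule.Build presAlg pres_addA pres_addC pres_add0 pres_addN.

Lemma pres_mulA : associative pres_mul.
Proof.
elim/pres_ind=> s; elim/pres_ind=> t; elim/pres_ind=> u; rewrite !piE.
exact/pres_piP/CMulA.
Qed.
Lemma pres_mul1l : left_id (pres_pi TOne) pres_mul.
Proof. by elim/pres_ind=> s; rewrite !piE; apply/pres_piP/CMul1l. Qed.
Lemma pres_mul1r : right_id (pres_pi TOne) pres_mul.
Proof. by elim/pres_ind=> s; rewrite !piE; apply/pres_piP/CMul1r. Qed.
Lemma pres_mulDl : left_distributive pres_mul +%R.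
Proof.
elim/pres_ind=> s; elim/pres_ind=> t; elim/pres_ind=> u.
by rewrite /GRing.add /= !piE; apply/pres_piP/CMulDl.
Qed.
Lemma pres_mulDr : right_distributive pres_mul +%R.
Proof.
elim/pres_ind=> s; elim/pres_ind=> t; elim/pres_ind=> u.
by rewrite /GRing.add /= !piE; apply/pres_piP/CMulDr.
Qed.

Section Lift.
Variables (A : algType K) (f : pres_gen P -> A).
Hypothesis fP : respects (@pres_rel K P) f.

Definition pres_lift of respects (@pres_rel K P) f :=
  fun x : presAlg => alg_eval f (repr x).

Lemma pres_lift_pi s : pres_lift fP (pres_pi s) = alg_eval f s.
Proof. exact/(alg_eval_cong fP)/repr_pres_pi. Qed.
End Lift.

Lemma pres_oner_neq0 : pres_pi TOne != 0.
Proof.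
apply/eqP => /(congr1 (pres_lift (@pres_augP K P))).
by rewrite !pres_lift_pi /= => /eqP; rewrite oner_eq0.
Qed.

HB.instance Definition _ := GRing.Zmodule_isNzRing.Build presAlg
  pres_mulA pres_mul1l pres_mul1r pres_mulDl pres_mulDr pres_oner_neq0.

Lemma pres_scaleA a b x :
  pres_scale a (pres_scale b x) = pres_scale (a * b) x.
Proof. by elim/pres_ind: x => s; rewrite !piE; apply/pres_piP/CScaleA. Qed.
Lemma pres_scale1 : left_id 1 pres_scale.
Proof. by elim/pres_ind=> s; rewrite !piE; apply/pres_piP/CScale1. Qed.
Lemma pres_scaleDr : right_distributive pres_scale +%R.
Proof.
move=> a; elim/pres_ind=> s; elim/pres_ind=> t.
by rewrite /GRing.add /= !piE; apply/pres_piP/CScaleDr.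
Qed.
Lemma pres_scaleDl x : {morph pres_scale^~ x : a b / a + b}.
Proof.
move=> a b; elim/pres_ind: x => s.
by rewrite [RHS]/GRing.add /= !piE; apply/pres_piP/CScaleDl.
Qed.

HB.instance Definition _ := GRing.Zmodule_isLmodule.Build K presAlg
  pres_scaleA pres_scale1 pres_scaleDr pres_scaleDl.

Lemma pres_scaleAl (a : K) (x y : presAlg) : a *: (x * y) = a *: x * y.
Proof.
elim/pres_ind: x => s; elim/pres_ind: y => t.
by rewrite /GRing.scale /GRing.mul /= !piE; apply/pres_piP/CScaleAl.
Qed.
HB.instance Definition _ := GRing.Lmodule_isLalgebra.Build K presAlg pres_scaleAl.

Lemma pres_scaleAr (a : K) (x y : presAlg) : a *: (x * y) = x * (a *: y).
Proof.
elim/pres_ind: x => s; elim/pres_ind: y => t.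
by rewrite /GRing.scale /GRing.mul /= !piE; apply/pres_piP/CScaleAr.
Qed.
HB.instance Definition _ := GRing.Lalgebra_isAlgebra.Build K presAlg pres_scaleAr.

Lemma presD s t : pres_pi s + pres_pi t = pres_pi (TAdd s t).
Proof. exact: pres_piD. Qed.
Lemma presM s t : pres_pi s * pres_pi t = pres_pi (TMul s t).
Proof. exact: pres_piM. Qed.
Lemma presN s : - pres_pi s = pres_pi (TOpp s).
Proof. exact: pres_piN. Qed.
Lemma presZ a s : a *: pres_pi s = pres_pi (TScale a s).
Proof. exact: pres_piZ. Qed.
Lemma pres1 : 1 = pres_pi TOne.
Proof. by []. Qed.

Section LiftMorphism.
Variables (A : algType K) (f : pres_gen P -> A).
Hypothesis fP : respects (@pres_rel K P) f.

Lemma pres_lift_is_additive : zmod_morphism (pres_lift fP).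
Proof.
elim/pres_ind=> s; elim/pres_ind=> t.
rewrite /GRing.add /GRing.opp /= pres_piN pres_piD !pres_lift_pi /=.
by rewrite /GRing.add /GRing.opp.
Qed.
HB.instance Definition _ :=
  GRing.isZmodMorphism.Build presAlg A (pres_lift fP) pres_lift_is_additive.

Lemma pres_lift_is_multiplicative : monoid_morphism (pres_lift fP).
Proof.
split; first exact: pres_lift_pi.
elim/pres_ind=> s; elim/pres_ind=> t.
by rewrite [X in pres_lift _ X]/GRing.mul /= pres_piM !pres_lift_pi.
Qed.
HB.instance Definition _ :=
  GRing.isMonoidMorphism.Build presAlg A (pres_lift fP)
    pres_lift_is_multiplicative.

Lemma pres_lift_is_scalable : scalable (pres_lift fP).
Proof.
move=> a; elim/pres_ind=> s.
by rewrite [X in pres_lift _ X]/GRing.scale /= pres_piZ !pres_lift_pi.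
Qed.
HB.instance Definition _ :=
  GRing.isScalable.Build K presAlg A *:%R (pres_lift fP) pres_lift_is_scalable.

End LiftMorphism.

HB.instance Definition _ := hasAugmentation.Build K presAlg
  (pres_lift (@pres_augP K P)).

End PresentedAlgebra.

HB.mixin Record Lmodule_isLie (K : comNzRingType) L of GRing.Lmodule K L := {
  lieb : L -> L -> L;
  liebPl : forall (a : K) (x y z : L),
    lieb (a *: x + y) z = a *: lieb x z + lieb y z;
  liebPr : forall (a : K) (x y z : L),
    lieb x (a *: y + z) = a *: lieb x y + lieb x z;
  liebxx : forall x : L, lieb x x = 0;
  lieJ : forall x y z : L,
    lieb x (lieb y z) + lieb y (lieb z x) + lieb z (lieb x y) = 0
}.

#[short(type="lieAlgType")]
HB.structure Definition LieAlgebra (K : comNzRingType) :=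
  {L of GRing.Lmodule K L & Lmodule_isLie K L}.

Section EnvelopingAlgebra.
Variables (K : comNzRingType) (L : lieAlgType K).

Inductive env_rel : alg_term K L -> alg_term K L -> Prop :=
| EnvAdd (x y : L) : env_rel (TGen (x + y)) (TAdd (TGen x) (TGen y))
| EnvScale (a : K) (x : L) : env_rel (TGen (a *: x)) (TScale a (TGen x))
| EnvBracket (x y : L) : env_rel (TGen (lieb x y))
    (TAdd (TMul (TGen x) (TGen y)) (TOpp (TMul (TGen y) (TGen x)))).

Lemma env_augP : respects env_rel (fun _ : L => 0 : K^o).
Proof.
by move=> s t [x y|a x|x y] /=; rewrite ?addr0 ?scaler0 ?mulr0 ?subr0.
Qed.

Definition env_pres := Presentation env_augP.

Definition env := presAlg env_pres.
HB.instance Definition _ := AugAlgebra.on env.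

Definition env_in (x : L) : env := @pres_pi K env_pres (TGen x).

Lemma env_inD x y : env_in (x + y) = env_in x + env_in y.
Proof. by rewrite presD; apply/pres_piP/CRel/EnvAdd. Qed.

Lemma env_inZ a x : env_in (a *: x) = a *: env_in x.
Proof. by rewrite presZ; apply/pres_piP/CRel/EnvScale. Qed.

Lemma env_in_bracket x y :
  env_in (lieb x y) = env_in x * env_in y - env_in y * env_in x.
Proof. by rewrite 2!presM presN presD; apply/pres_piP/CRel/EnvBracket. Qed.

End EnvelopingAlgebra.

Section TensorProduct.
Variables (K : comNzRingType) (A B : augAlgType K).

(* The generator (a, b) stands for the pure tensor of a and b.  By the last two
   relations every element is a sum of pure tensors, so the quotient is the
   tensor product of modules with its usual multiplication. *)
Inductive tens_rel : alg_term K (A * B) -> alg_term K (A * B) -> Prop :=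
| TensDl a a' b :
    tens_rel (TGen (a + a', b)) (TAdd (TGen (a, b)) (TGen (a', b)))
| TensDr a b b' :
    tens_rel (TGen (a, b + b')) (TAdd (TGen (a, b)) (TGen (a, b')))
| TensZl k a b : tens_rel (TGen (k *: a, b)) (TScale k (TGen (a, b)))
| TensZr k a b : tens_rel (TGen (a, k *: b)) (TScale k (TGen (a, b)))
| TensM a a' b b' :
    tens_rel (TGen (a * a', b * b')) (TMul (TGen (a, b)) (TGen (a', b')))
| Tens1 : tens_rel (TGen (1, 1)) TOne.

Lemma tens_respects (C : algType K) (f : {lrmorphism A -> C})
    (g : {lrmorphism B -> C}) :
  (forall a b, f a * g b = g b * f a) ->
  respects tens_rel (fun ab => f ab.1 * g ab.2).
Proof.
move=> fgC s t [a a' b|a b b'|k a b|k a b|a a' b b'|] /=.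
- by rewrite rmorphD mulrDl.
- by rewrite rmorphD mulrDr.
- by rewrite linearZ /= scalerAl.
- by rewrite linearZ /= scalerAr.
- rewrite !rmorphM !mulrA; congr (_ * _); rewrite -!mulrA; congr (_ * _).
  exact: fgC.
- by rewrite !rmorph1 mulr1.
Qed.

Lemma tens_augP :
  respects tens_rel (fun ab => augm A ab.1 * augm B ab.2 : K^o).
Proof. by apply: tens_respects => a b; apply: mulrC. Qed.

Definition tens_pres := Presentation tens_augP.

Definition tens := presAlg tens_pres.
HB.instance Definition _ := AugAlgebra.on tens.

Definition tmul (a : A) (b : B) : tens := @pres_pi K tens_pres (TGen (a, b)).

Lemma tmulDl a a' b : tmul (a + a') b = tmul a b + tmul a' b.
Proof. by rewrite presD; apply/pres_piP/CRel/TensDl. Qed.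

Lemma tmulDr a b b' : tmul a (b + b') = tmul a b + tmul a b'.
Proof. by rewrite presD; apply/pres_piP/CRel/TensDr. Qed.

Lemma tmulZl k a b : tmul (k *: a) b = k *: tmul a b.
Proof. by rewrite presZ; apply/pres_piP/CRel/TensZl. Qed.

Lemma tmulZr k a b : tmul a (k *: b) = k *: tmul a b.
Proof. by rewrite presZ; apply/pres_piP/CRel/TensZr. Qed.

Lemma tmulM a a' b b' : tmul a b * tmul a' b' = tmul (a * a') (b * b').
Proof. by rewrite presM; apply/pres_piP/CSym/CRel/TensM. Qed.

Lemma tmul11 : tmul 1 1 = 1.
Proof. by rewrite pres1; apply/pres_piP/CRel/Tens1. Qed.

Lemma tmulN1l a b : tmul (- a) b = - tmul a b.
Proof. by rewrite -scaleN1r tmulZl scaleN1r. Qed.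

Lemma tmulN1r a b : tmul a (- b) = - tmul a b.
Proof. by rewrite -scaleN1r tmulZr scaleN1r. Qed.

Definition tens_inl (a : A) : tens := tmul a 1.
Definition tens_inr (b : B) : tens := tmul 1 b.

Lemma tens_inl_is_additive : zmod_morphism tens_inl.
Proof. by move=> a a'; rewrite /tens_inl tmulDl tmulN1l. Qed.
Lemma tens_inl_is_multiplicative : monoid_morphism tens_inl.
Proof. by split=> [|a a']; rewrite ?tmulM ?mulr1 //; apply: tmul11. Qed.
Lemma tens_inl_is_scalable : scalable tens_inl.
Proof. by move=> k a; apply: tmulZl. Qed.
HB.instance Definition _ :=
  GRing.isZmodMorphism.Build A tens tens_inl tens_inl_is_additive.
HB.instance Definition _ :=
  GRing.isMonoidMorphism.Build A tens tens_inl tens_inl_is_multiplicative.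
HB.instance Definition _ :=
  GRing.isScalable.Build K A tens *:%R tens_inl tens_inl_is_scalable.

Lemma tens_inr_is_additive : zmod_morphism tens_inr.
Proof. by move=> b b'; rewrite /tens_inr tmulDr tmulN1r. Qed.
Lemma tens_inr_is_multiplicative : monoid_morphism tens_inr.
Proof. by split=> [|b b']; rewrite ?tmulM ?mulr1 //; apply: tmul11. Qed.
Lemma tens_inr_is_scalable : scalable tens_inr.
Proof. by move=> k b; apply: tmulZr. Qed.
HB.instance Definition _ :=
  GRing.isZmodMorphism.Build B tens tens_inr tens_inr_is_additive.
HB.instance Definition _ :=
  GRing.isMonoidMorphism.Build B tens tens_inr tens_inr_is_multiplicative.
HB.instance Definition _ :=
  GRing.isScalable.Build K B tens *:%R tens_inr tens_inr_is_scalable.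

Lemma tens_inlrC a b : tens_inl a * tens_inr b = tens_inr b * tens_inl a.
Proof. by rewrite !tmulM !mulr1 !mul1r. Qed.

Definition tens_lift (C : algType K) (f : {lrmorphism A -> C})
    (g : {lrmorphism B -> C}) (fgC : forall a b, f a * g b = g b * f a) :
    {lrmorphism tens -> C} :=
  pres_lift (tens_respects fgC : respects (@pres_rel K tens_pres) _).

Lemma tens_lift_tmul (C : algType K) (f : {lrmorphism A -> C})
    (g : {lrmorphism B -> C}) (fgC : forall a b, f a * g b = g b * f a) a b :
  tens_lift fgC (tmul a b) = f a * g b.
Proof. exact: pres_lift_pi. Qed.

End TensorProduct.

Arguments tens_inl {K A} B a.
Arguments tens_inr {K} A {B} b.

Section TensorMaps.
Variable K : comNzRingType.

Lemma tens_mapC (A B A' B' : augAlgType K) (f : {lrmorphism A -> A'})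
    (g : {lrmorphism B -> B'}) a b :
  (tens_inl B' \o f) a * (tens_inr A' \o g) b =
  (tens_inr A' \o g) b * (tens_inl B' \o f) a.
Proof. exact: tens_inlrC. Qed.

Definition tens_map (A B A' B' : augAlgType K) (f : {lrmorphism A -> A'})
    (g : {lrmorphism B -> B'}) : {lrmorphism tens A B -> tens A' B'} :=
  tens_lift (tens_mapC f g).

Lemma tens_mapE (A B A' B' : augAlgType K) (f : {lrmorphism A -> A'})
    (g : {lrmorphism B -> B'}) a b :
  tens_map f g (tmul a b) = tmul (f a) (g b).
Proof. by rewrite tens_lift_tmul /= tmulM mulr1 mul1r. Qed.

Lemma tens_ind (A B : augAlgType K) (Q : tens A B -> Prop) :
  (forall a b, Q (tmul a b)) -> (forall x y, Q x -> Q y -> Q (x + y)) ->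
  forall x, Q x.
Proof.
move=> Qt QD.
have Q0 : Q 0 by rewrite -(scale0r (tmul 1 1)) -tmulZl.
suff QE x : exists s : seq (A * B), x = \sum_(ab <- s) tmul ab.1 ab.2.
  move=> x; have [s ->] := QE x; elim: s => [|ab s IHs]; first by rewrite big_nil.
  by rewrite big_cons; apply: QD.
elim/pres_ind: x => t; elim: t => [[a b]|||t [s E]|t [s E] t' [s' E']
  |t [s E] t' [s' E']|k t [s E]].
- by exists [:: (a, b)]; rewrite big_seq1.
- by exists [::]; rewrite big_nil.
- by exists [:: (1, 1)]; rewrite big_seq1 tmul11.
- exists [seq (- ab.1, ab.2) | ab <- s]; rewrite -presN E big_map -sumrN.
  by apply: eq_bigr => ab _; rewrite tmulN1l.
- by exists (s ++ s'); rewrite -presD E E' big_cat.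
- exists [seq (x.1 * y.1, x.2 * y.2) | x <- s, y <- s'].
  rewrite -presM E E' big_allpairs_dep big_distrlr.
  by apply: eq_bigr => x _; apply: eq_bigr => y _; rewrite /= tmulM.
- exists [seq (k *: ab.1, ab.2) | ab <- s]; rewrite -presZ E big_map scaler_sumr.
  by apply: eq_bigr => ab _; rewrite tmulZl.
Qed.

Variables A B C : augAlgType K.

Lemma tens_assocC a x :
  (tens_inl C \o tens_inl B) a * tens_map (tens_inr A) (@idfun C) x =
  tens_map (tens_inr A) (@idfun C) x * (tens_inl C \o tens_inl B) a.
Proof.
elim/tens_ind: x => [b c|x y IHx IHy].
  by rewrite tens_mapE /= !tmulM !mulr1 !mul1r.
by rewrite rmorphD mulrDl mulrDr IHx IHy.
Qed.

Definition tens_assoc :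
    {lrmorphism tens A (tens B C) -> tens (tens A B) C} :=
  tens_lift tens_assocC.

Lemma tens_assocE a b c : tens_assoc (tmul a (tmul b c)) = tmul (tmul a b) c.
Proof. by rewrite tens_lift_tmul tens_mapE /= !tmulM !(mulr1, mul1r). Qed.

End TensorMaps.

Section Counits.
Variable K : comNzRingType.

Definition aug_in (A B : augAlgType K) (a : A) : B := (augm A a : K)%:A.

Lemma aug_in_is_additive (A B : augAlgType K) : zmod_morphism (@aug_in A B).
Proof. by move=> a a'; rewrite /aug_in rmorphB scalerBl. Qed.
Lemma aug_in_is_multiplicative (A B : augAlgType K) :
  monoid_morphism (@aug_in A B).
Proof.
split=> [|a a']; rewrite /aug_in ?rmorph1 ?scale1r // rmorphM.
by rewrite mulr_algl scalerA.
Qed.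
Lemma aug_in_is_scalable (A B : augAlgType K) : scalable (@aug_in A B).
Proof. by move=> k a; rewrite /aug_in linearZ scalerA. Qed.
HB.instance Definition _ (A B : augAlgType K) :=
  GRing.isZmodMorphism.Build A B (@aug_in A B) (@aug_in_is_additive A B).
HB.instance Definition _ (A B : augAlgType K) :=
  GRing.isMonoidMorphism.Build A B (@aug_in A B) (@aug_in_is_multiplicative A B).
HB.instance Definition _ (A B : augAlgType K) :=
  GRing.isScalable.Build K A B *:%R (@aug_in A B) (@aug_in_is_scalable A B).

Variables A B : augAlgType K.

Lemma tens_augmlC a b :
  aug_in B (a : A) * @idfun B b = @idfun B b * aug_in B (a : A).
Proof. by rewrite mulr_algl mulr_algr. Qed.

Lemma tens_augmrC a b :
  @idfun A a * aug_in A (b : B) = aug_in A (b : B) * @idfun A a.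
Proof. by rewrite mulr_algl mulr_algr. Qed.

(* The maps eps (x) id and id (x) eps, where K (x) B and A (x) K are identified
   with B and A. *)
Definition tens_augml : {lrmorphism tens A B -> B} := tens_lift tens_augmlC.
Definition tens_augmr : {lrmorphism tens A B -> A} := tens_lift tens_augmrC.

Lemma tens_augmlE a b : tens_augml (tmul a b) = (augm A a : K) *: b.
Proof. by rewrite tens_lift_tmul mulr_algl. Qed.

Lemma tens_augmrE a b : tens_augmr (tmul a b) = (augm B b : K) *: a.
Proof. by rewrite tens_lift_tmul mulr_algr. Qed.

End Counits.

Section Coproduct.
Variables (K : comNzRingType) (L : lieAlgType K).

Definition primitive (x : L) : tens (env L) (env L) :=
  tmul (env_in x) 1 + tmul 1 (env_in x).

Lemma primitive_respects : respects (@pres_rel K (env_pres L)) primitive.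
Proof.
rewrite /primitive => s t [x y|a x|x y] /=.
- by rewrite env_inD tmulDl tmulDr addrACA.
- by rewrite env_inZ tmulZl tmulZr scalerDr.
rewrite env_in_bracket tmulDl tmulDr tmulN1l tmulN1r.
rewrite !(mulrDl, mulrDr) !tmulM !(mulr1, mul1r).
have E (a b c d e f : tens (env L) (env L)) :
    a - c + (b - d) = a + e + (f + b) - (c + f + (e + d)).
  rewrite (addrC f b) (addrACA a e) (addrC e d) (addrACA c f) (addrC f e).
  by rewrite opprD (addrACA (a + b)) subrr addr0 opprD addrACA.
exact: E.
Qed.

Definition coprod : {lrmorphism env L -> tens (env L) (env L)} :=
  pres_lift primitive_respects.

Definition counit : {lrmorphism env L -> K^o} := augm (env L).

Lemma coprod_in x : coprod (env_in x) = tmul (env_in x) 1 + tmul 1 (env_in x).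
Proof. exact: pres_lift_pi. Qed.

Lemma counit_in x : counit (env_in x) = 0.
Proof. exact: pres_lift_pi. Qed.

End Coproduct.

(* [fps A] is A[[xi]].  The xi-adically completed tensor product of A[[xi]] and B[[xi]] is
   (A (x) B)[[xi]], here [fps (tens A B)]. *)

Record fps (A : Type) := Fps { fcoef :> nat -> A }.

HB.instance Definition _ (A : Type) := gen_eqMixin (fps A).
HB.instance Definition _ (A : Type) := gen_choiceMixin (fps A).

Lemma fpsP (A : Type) (p q : fps A) : (forall n, p n = q n) -> p = q.
Proof. by case: p q => [p] [q] pq; congr Fps; apply: funext. Qed.

Section FpsZmodule.
Variable A : zmodType.
Implicit Types p q r : fps A.

Definition fps_add p q : fps A := Fps (fun n => p n + q n).
Definition fps_opp p : fps A := Fps (fun n => - p n).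
Definition fps_zero : fps A := Fps (fun=> 0).

Lemma fps_addA : associative fps_add.
Proof. by move=> p q r; apply: fpsP => n /=; rewrite addrA. Qed.
Lemma fps_addC : commutative fps_add.
Proof. by move=> p q; apply: fpsP => n /=; rewrite addrC. Qed.
Lemma fps_add0 : left_id fps_zero fps_add.
Proof. by move=> p; apply: fpsP => n /=; rewrite add0r. Qed.
Lemma fps_addN : left_inverse fps_zero fps_opp fps_add.
Proof. by move=> p; apply: fpsP => n /=; rewrite addNr. Qed.

HB.instance Definition _ :=
  GRing.isZmodule.Build (fps A) fps_addA fps_addC fps_add0 fps_addN.
End FpsZmodule.

Section FpsRing.
Variable A : nzRingType.
Implicit Types p q r : fps A.

Definition fps_one : fps A := Fps (fun n => (n == 0)%:R).
Definition fps_mul p q : fps A :=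
  Fps (fun n => \sum_(i < n.+1) p i * q (n - i)%N).

Lemma fps_mul_rev p q n :
  fps_mul p q n = \sum_(i < n.+1) p (n - i)%N * q i.
Proof.
rewrite /= (reindex_inj rev_ord_inj) /=.
by apply: eq_bigr => i _; rewrite subSS subKn // -ltnS.
Qed.

Lemma fps_mulA : associative fps_mul.
Proof.
move=> p q r; apply: fpsP => n; rewrite [RHS]fps_mul_rev [LHS]/=.
pose coef3 j k := p j * (q (n - j - k)%N * r k).
transitivity (\sum_(j < n.+1) \sum_(k < n.+1 | (k <= n - j)%N) coef3 j k).
  apply: eq_bigr => /= j _; have /= -> := fps_mul_rev q r (n - j).
  by rewrite big_distrr /= (big_ord_narrow_leq (leq_subr _ _)).
rewrite (exchange_big_dep predT) //=; apply: eq_bigr => k _.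
transitivity (\sum_(j < n.+1 | (j <= n - k)%N) coef3 j k).
  apply: eq_bigl => j; rewrite -ltnS -(ltnS j) -!subSn ?leq_ord //.
  by rewrite -subn_gt0 -(subn_gt0 j) -!subnDA addnC.
rewrite (big_ord_narrow_leq (leq_subr _ _)) big_distrl /=.
by apply: eq_bigr => j _; rewrite /coef3 -!subnDA addnC mulrA.
Qed.

Lemma fps_mul1l : left_id fps_one fps_mul.
Proof.
move=> p; apply: fpsP => n /=; rewrite big_ord_recl /= subn0 mul1r.
by rewrite big1 ?addr0 // => i _; rewrite mul0r.
Qed.
Lemma fps_mul1r : right_id fps_one fps_mul.
Proof.
move=> p; apply: fpsP => n; rewrite fps_mul_rev big_ord_recl /= subn0 mulr1.
by rewrite big1 ?addr0 // => i _; rewrite mulr0.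
Qed.
Lemma fps_mulDl : left_distributive fps_mul +%R.
Proof.
move=> p q r; apply: fpsP => n /=; rewrite -big_split /=.
by apply: eq_bigr => i _; rewrite mulrDl.
Qed.
Lemma fps_mulDr : right_distributive fps_mul +%R.
Proof.
move=> p q r; apply: fpsP => n /=; rewrite -big_split /=.
by apply: eq_bigr => i _; rewrite mulrDr.
Qed.
Lemma fps_oner_neq0 : fps_one != 0.
Proof.
by apply/eqP => /(congr1 (fun p : fps A => p 0%N)) /eqP; rewrite /= oner_eq0.
Qed.

HB.instance Definition _ := GRing.Zmodule_isNzRing.Build (fps A)
  fps_mulA fps_mul1l fps_mul1r fps_mulDl fps_mulDr fps_oner_neq0.

Definition fpsC (a : A) : fps A := Fps (fun n => if n == 0 then a else 0).
Definition fpsX : fps A := Fps (fun n => (n == 1)%:R).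
End FpsRing.

Arguments fpsX {A}.

Section FpsAlgebra.
Variable (K : comNzRingType).

Section Lmodule.
Variable A : lmodType K.
Definition fps_scale (a : K) (p : fps A) : fps A := Fps (fun n => a *: p n).

Lemma fps_scaleA a b p : fps_scale a (fps_scale b p) = fps_scale (a * b) p.
Proof. by apply: fpsP => n /=; rewrite scalerA. Qed.
Lemma fps_scale1 : left_id 1 fps_scale.
Proof. by move=> p; apply: fpsP => n /=; rewrite scale1r. Qed.
Lemma fps_scaleDr : right_distributive fps_scale +%R.
Proof. by move=> a p q; apply: fpsP => n /=; rewrite scalerDr. Qed.
Lemma fps_scaleDl p : {morph fps_scale^~ p : a b / a + b}.
Proof. by move=> a b; apply: fpsP => n /=; rewrite scalerDl. Qed.
HB.instance Definition _ := GRing.Zmodule_isLmodule.Build K (fps A)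
  fps_scaleA fps_scale1 fps_scaleDr fps_scaleDl.
End Lmodule.

Variable A : algType K.

Lemma fps_scaleAl (a : K) (p q : fps A) : a *: (p * q) = a *: p * q.
Proof.
apply: fpsP => n /=; rewrite scaler_sumr.
by apply: eq_bigr => i _; rewrite scalerAl.
Qed.
HB.instance Definition _ := GRing.Lmodule_isLalgebra.Build K (fps A) fps_scaleAl.

Lemma fps_scaleAr (a : K) (p q : fps A) : a *: (p * q) = p * (a *: q).
Proof.
apply: fpsP => n /=; rewrite scaler_sumr.
by apply: eq_bigr => i _; rewrite scalerAr.
Qed.
HB.instance Definition _ := GRing.Lalgebra_isAlgebra.Build K (fps A) fps_scaleAr.

End FpsAlgebra.

Definition fps_map (A B : Type) (f : A -> B) (p : fps A) : fps B :=
  Fps (fun n => f (p n)).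

Definition fps_tmul (K : comNzRingType) (A B : augAlgType K)
    (p : fps A) (q : fps B) : fps (tens A B) :=
  Fps (fun n => \sum_(i < n.+1) tmul (p i) (q (n - i)%N)).

Section Series.
Variables (K : fieldType) (A : algType K).

(* The sum over k of c k *: p ^+ k, for p without constant term: then p ^+ k
   has no coefficient of index n < k, so the sum below can stop at k = n. *)
Definition fps_subst (c : nat -> K) (p : fps A) : fps A :=
  Fps (fun n => \sum_(k < n.+1) c k *: (p ^+ k) n).

(* Meaningful when p has constant term 0. *)
Definition fps_exp (p : fps A) : fps A := fps_subst (fun k => k`!%:R^-1) p.

(* Meaningful when p has constant term 1; the term k = 0 vanishes since
   0^-1 = 0. *)
Definition fps_ln (p : fps A) : fps A :=
  fps_subst (fun k => (-1) ^+ k.+1 / k%:R) (p - 1).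

(* The two-sided inverse of p if p is invertible, and 1 otherwise. *)
Definition fps_inv (p : fps A) : fps A :=
  xget 1 [set q | p * q = 1 /\ q * p = 1].

End Series.

Section Twist.
Variables (K : fieldType) (L : lieAlgType K).
Local Notation U := (env L).

(* The two sides of the cocycle equation live in (U (x) U) (x) U and
   U (x) (U (x) U); the latter is mapped to the former by [tens_assoc]. *)
Definition is_twist (F : fps (tens U U)) : Prop :=
  [/\ exists G, F * G = 1 /\ G * F = 1,
      fps_map (tens_inl U) F * fps_map (tens_map (coprod L) idfun) F =
      fps_map (@tens_assoc K U U U)
        (fps_map (tens_inr U) F * fps_map (tens_map idfun (coprod L)) F),
      fps_map (@tens_augml K U U) F = 1
    & fps_map (@tens_augmr K U U) F = 1].

Definition twisted_coprod (F : fps (tens U U)) (x : fps U) : fps (tens U U) :=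
  F * fps_map (coprod L) x * fps_inv F.

End Twist.

Section SpecialLinear.
Variables (K : comNzRingType) (n : nat).

Definition traceless : {pred 'M[K]_n} := fun A => \tr A == 0.

Lemma traceless_submod : submod_closed traceless.
Proof.
split=> [|a A B]; rewrite !unfold_in ?mxtrace0 //.
by move=> /eqP A0 /eqP B0; rewrite mxtraceD mxtraceZ A0 B0 mulr0 addr0.
Qed.
HB.instance Definition _ :=
  GRing.isSubmodClosed.Build K 'M[K]_n traceless traceless_submod.

Record sl := Sl { slval :> 'M[K]_n; slvalP : slval \in traceless }.

HB.instance Definition _ := [isSub for slval].
HB.instance Definition _ := [Choice of sl by <:].
HB.instance Definition _ := [SubChoice_isSubLmodule of sl by <:].

Lemma sl_bracket_subproof (x y : sl) :
  (x : 'M_n) *m y - (y : 'M_n) *m x \in traceless.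
Proof. by rewrite unfold_in raddfB /= mxtrace_mulC subrr. Qed.

Definition sl_bracket (x y : sl) : sl := Sl (sl_bracket_subproof x y).

Lemma sl_bracketPl (a : K) (x y z : sl) :
  sl_bracket (a *: x + y) z = a *: sl_bracket x z + sl_bracket y z.
Proof.
apply: val_inj => /=.
by rewrite mulmxDl mulmxDr -scalemxAl -scalemxAr scalerBr opprD addrACA.
Qed.
Lemma sl_bracketPr (a : K) (x y z : sl) :
  sl_bracket x (a *: y + z) = a *: sl_bracket x y + sl_bracket x z.
Proof.
apply: val_inj => /=.
by rewrite mulmxDl mulmxDr -scalemxAl -scalemxAr scalerBr opprD addrACA.
Qed.
Lemma sl_bracketxx (x : sl) : sl_bracket x x = 0.
Proof. by apply: val_inj; rewrite /= subrr. Qed.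
Lemma sl_bracketJ (x y z : sl) :
  sl_bracket x (sl_bracket y z) + sl_bracket y (sl_bracket z x) +
  sl_bracket z (sl_bracket x y) = 0.
Proof.
apply: val_inj => /=; case: x y z => [x _] [y _] [z _] /=.
rewrite !(mulmxBl, mulmxBr) !mulmxA.
have E (a b c d e f : 'M[K]_n) :
    a - b - (c - d) + (c - e - (f - b)) + (f - d - (a - e)) = 0.
  by apply/matrixP => i j; rewrite !mxE; ring.
exact: E.
Qed.

HB.instance Definition _ := Lmodule_isLie.Build K sl
  sl_bracketPl sl_bracketPr sl_bracketxx sl_bracketJ.

End SpecialLinear.

Arguments traceless {K n}.

(* The matrix indices 1, 2, 3 are 0, 1, 2 in ['I_3]. *)

Section SpecialLinear3.
Variable K : fieldType.

Lemma sl_unit_subproof (n : nat) (a b : 'I_n) :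
  a != b -> (delta_mx a b : 'M[K]_n) \in traceless.
Proof.
move=> ab; rewrite unfold_in /mxtrace big1 // => i _; rewrite mxE.
by case: eqP => //= ->; rewrite (negPf ab).
Qed.

Definition sl_unit (n : nat) (a b : 'I_n) (ab : a != b) : sl K n :=
  Sl (sl_unit_subproof ab).

Definition e12 : sl K 3 := @sl_unit 3 0 1 isT.
Definition e13 : sl K 3 := @sl_unit 3 0 2 isT.
Definition e23 : sl K 3 := @sl_unit 3 1 2 isT.
Definition e21 : sl K 3 := @sl_unit 3 1 0 isT.
Definition e31 : sl K 3 := @sl_unit 3 2 0 isT.
Definition e32 : sl K 3 := @sl_unit 3 2 1 isT.

Lemma h13_subproof :
  2^-1 *: (delta_mx 0 0 - delta_mx 2 2) \in (traceless : {pred 'M[K]_3}).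
Proof.
rewrite unfold_in mxtraceZ /mxtrace !big_ord_recl big_ord0 !mxE /=.
by apply/eqP; ring.
Qed.

Definition h13 : sl K 3 := Sl h13_subproof.

Lemma hperp_subproof :
  2^-1 *: (delta_mx 0 0 - 2 *: delta_mx 1 1 + delta_mx 2 2)
    \in (traceless : {pred 'M[K]_3}).
Proof.
rewrite unfold_in mxtraceZ /mxtrace !big_ord_recl big_ord0 !mxE /=.
by apply/eqP; ring.
Qed.

Definition hperp : sl K 3 := Sl hperp_subproof.

End SpecialLinear3.

Arguments e12 {K}.
Arguments e13 {K}.
Arguments e23 {K}.
Arguments e21 {K}.
Arguments e31 {K}.
Arguments e32 {K}.
Arguments h13 {K}.
Arguments hperp {K}.

Definition fps_in (K : comNzRingType) (L : lieAlgType K) (x : L) : fps (env L) :=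
  fpsC (env_in x).

Notation "p \ox q" := (fps_tmul p q)
  (at level 41, right associativity) : ring_scope.
Notation "''xi'" := fpsX : ring_scope.

(* Main.v *)
Require Import Defs.
From HB Require Import structures.
From mathcomp Require Import all_boot all_order all_algebra.
From mathcomp Require Import boolp classical_sets ring zify.
From mathcomp Require Import reals complex.

(* Write F = Q P with P = exp(h (x) sigma) the Jordanian twist and
   Q = exp(xi e12 (x) e23 e^(c sigma)), c = (3 gamma - 1)/2.  Since
   [h, e13] = e13, the commutators of sigma = ln(1 + xi e13) with the generators
   are polynomial in e^(-sigma), and the adjoint actions of the two exponents on
   the generators are either diagonal or nilpotent of order at most 3.  Hence P
   and Q can be moved past every generator explicitly, and each identity
   F Delta(x) = Delta_F(x) F becomes an identity between noncommutative
   polynomials modulo quadratic commutation rules, which is checked by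
   normalization.  The coproduct of sigma is recovered from that of e^sigma by
   injectivity of exp.

   For the cocycle equation, X = e23 e^(c sigma) satisfies
   Delta_F(X) = X (x) 1 + e^((c+1) sigma) (x) X, so that the two sides,
   F_12 (Delta (x) id)(F) and (id (x) Delta_F)(F) F_23, are products of
   exponentials that agree after moving exp(h (x) sigma (x) 1) past
   exp(xi e12 (x) 1 (x) X). *)

Set Implicit Arguments.
Unset Strict Implicit.
Unset Printing Implicit Defensive.

Import GRing.Theory.
Local Open Scope ring_scope.

(** * Normal forms of noncommutative polynomials *)

(** The constant [c] has two roles: [- c] and [c + 1] are the weights of [e23] and [e12] under [h],
    and [c + 1] is also the exponent in the twisted coproduct of [X]. This coincidence is what makes
    the two sides of the cocycle equation meet. No basis of the enveloping algebra is used; every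
    identity is derived from quadratic relations. These close up because [xi e23] is taken as a
    letter: [[e12, xi e23] = e^sigma - 1], so [e13] itself disappears. The scaling [k = 2/3 hperp]
    gives weights 1 and -1 on the simple root vectors and their opposites, which keeps the
    coefficients integral. The obstacle is that, with [s = e^sigma], conjugation by [P] sends
    [s (x) 1] to [1 + (s - 1) (x) s], so the images of [s^-1 (x) 1] and [e^(c sigma) (x) 1] are not
    polynomial in the letters. Among the exponentials of the first tensor factor only [s] is
    therefore moved by normalization. The coproduct of [s^-1] then follows by inversion, that of
    [e^(c sigma)] from the one of [sigma], and that of [e23 e^(-sigma)] from the one of [xi e23] by
    cancelling [xi]. *)

Inductive nc_exp :=
| NcVar of nat
| NcZero
| NcOne
| NcOpp of nc_exp
| NcAdd of nc_exp & nc_exp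
| NcMul of nc_exp & nc_exp.

(* A signed word; integer coefficients are encoded by repetition. *)
Definition nc_term := (bool * seq nat)%type.

Fixpoint nc_insert (m : nc_term) (p : seq nc_term) : seq nc_term :=
  match p with
  | [::] => [:: m]
  | m' :: p' =>
      if (m.2 == m'.2) && (m.1 == ~~ m'.1) then p' else m' :: nc_insert m p'
  end.

Definition nc_mul (p q : seq nc_term) : seq nc_term :=
  foldr (fun m r =>
    map (fun m' => (m.1 (+) m'.1, m.2 ++ m'.2)) q ++ r) [::] p.

Definition nc_opp (p : seq nc_term) : seq nc_term :=
  map (fun m => (~~ m.1, m.2)) p.

Fixpoint nc_flat (e : nc_exp) : seq nc_term :=
  match e with
  | NcVar i => [:: (false, [:: i])]
  | NcZero => [::]
  | NcOne => [:: (false, [::])]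
  | NcOpp e => nc_opp (nc_flat e)
  | NcAdd e f => nc_flat e ++ nc_flat f
  | NcMul e f => nc_mul (nc_flat e) (nc_flat f)
  end.

Fixpoint nc_find (rules : seq (nat * nat * seq nc_term)) i j :=
  match rules with
  | [::] => None
  | (i', j', p) :: rules' =>
      if (i == i') && (j == j') then Some p else nc_find rules' i j
  end.

Fixpoint nc_step rules (w : seq nat) : option (seq nc_term) :=
  match w with
  | i :: ((j :: w') as w1) =>
      match nc_find rules i j with
      | Some p => Some (map (fun m => (m.1, m.2 ++ w')) p)
      | None => omap (map (fun m => (m.1, i :: m.2))) (nc_step rules w1)
      end
  | _ => None
  end.

(** When the fuel runs out the word is kept unreduced, which does not change the value of the sum:
    soundness holds for every amount of fuel, and only success depends on it. *)
Fixpoint nc_norm rules fuel (m : nc_term) (acc : seq nc_term) : seq nc_term :=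
  match fuel with
  | 0%N => m :: acc
  | n.+1 =>
      match nc_step rules m.2 with
      | None => nc_insert m acc
      | Some p =>
          foldr (fun m' => nc_norm rules n (m.1 (+) m'.1, m'.2)) acc p
      end
  end.

(** The tree mirrors nested conjunctions, so that [nc_sound] of a reified tree is convertible to the
    type of the proof from which the rules were read off. *)
Inductive nc_tree :=
| NcNil
| NcRule of nat & nat & nc_exp
| NcNode of nc_tree & nc_tree.

Fixpoint nc_rules (t : nc_tree) : seq (nat * nat * seq nc_term) :=
  match t with
  | NcNil => [::]
  | NcRule i j e => [:: (i, j, nc_flat e)]
  | NcNode t t' => nc_rules t ++ nc_rules t'
  end.

Definition nc_diff tree fuel e f :=
  let rules := nc_rules tree in
  foldr (nc_norm rules fuel) [::] (nc_flat (NcAdd e (NcOpp f))).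

Section NcSoundness.
Variables (A : nzRingType) (env : seq A).

Fixpoint nc_eval (e : nc_exp) : A :=
  match e with
  | NcVar i => nth 0 env i
  | NcZero => 0
  | NcOne => 1
  | NcOpp e => - nc_eval e
  | NcAdd e f => nc_eval e + nc_eval f
  | NcMul e f => nc_eval e * nc_eval f
  end.

Fixpoint nc_sound (t : nc_tree) : Prop :=
  match t with
  | NcNil => True
  | NcRule i j e => nth 0 env i * nth 0 env j = nc_eval e
  | NcNode t t' => nc_sound t /\ nc_sound t'
  end.

Definition nc_word (w : seq nat) : A := foldr (fun i x => nth 0 env i * x) 1 w.
Definition nc_value (m : nc_term) : A := (-1) ^+ m.1 * nc_word m.2.
Definition nc_sum (p : seq nc_term) : A := \sum_(m <- p) nc_value m.

Lemma nc_word_cat w w' : nc_word (w ++ w') = nc_word w * nc_word w'.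
Proof. by elim: w => [|i w IHw] /=; rewrite ?mul1r // IHw mulrA. Qed.

Lemma nc_value_mul b b' w w' :
  nc_value (b (+) b', w ++ w') = nc_value (b, w) * nc_value (b', w').
Proof.
rewrite /nc_value /= nc_word_cat signr_addb -!mulrA; congr (_ * _).
by rewrite !mulrA; congr (_ * _); case: b'; rewrite ?(mulN1r, mulrN1, mul1r, mulr1).
Qed.

Lemma nc_insertE m p : nc_sum (nc_insert m p) = nc_value m + nc_sum p.
Proof.
elim: p => [|m' p IHp] /=; first by rewrite /nc_sum big_seq1 big_nil addr0.
case: ifP => [/andP[/eqP wE /eqP bE]|_]; last first.
  by rewrite {1}/nc_sum big_cons -/(nc_sum _) IHp /nc_sum big_cons addrCA.
rewrite /nc_sum big_cons addrA /nc_value wE bE signrN mulNr addNr add0r //.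
Qed.

Lemma nc_oppE p : nc_sum (nc_opp p) = - nc_sum p.
Proof.
rewrite /nc_sum big_map -sumrN; apply: eq_bigr => m _.
by rewrite /nc_value signrN mulNr.
Qed.

Lemma nc_mulE p q : nc_sum (nc_mul p q) = nc_sum p * nc_sum q.
Proof.
elim: p => [|m p IHp] /=; first by rewrite /nc_sum !big_nil mul0r.
rewrite /nc_sum big_cat big_map /= -/(nc_sum _) IHp big_cons mulrDl.
congr (_ + _); rewrite mulr_sumr; apply: eq_bigr => m' _.
by rewrite nc_value_mul -!surjective_pairing.
Qed.

Lemma nc_flatE e : nc_sum (nc_flat e) = nc_eval e.
Proof.
elim: e => [i|||e IHe|e IHe f IHf|e IHe f IHf] /=.
- by rewrite /nc_sum big_seq1 /nc_value /= mul1r mulr1.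
- by rewrite /nc_sum big_nil.
- by rewrite /nc_sum big_seq1 /nc_value mul1r.
- by rewrite nc_oppE IHe.
- by rewrite /nc_sum big_cat /= -!/(nc_sum _) IHe IHf.
- by rewrite nc_mulE IHe IHf.
Qed.

Variable rules : nc_tree.
Hypothesis rulesP : nc_sound rules.

Lemma nc_find_cat rs rs' i j : nc_find (rs ++ rs') i j =
  if nc_find rs i j is Some p then Some p else nc_find rs' i j.
Proof. by elim: rs => //= -[[i' j'] p] rs ->; case: ifP. Qed.

Lemma nc_findE i j p : nc_find (nc_rules rules) i j = Some p ->
  nth 0 env i * nth 0 env j = nc_sum p.
Proof.
elim: rules rulesP p => [|i' j' e|t IHt t' IHt'] //=.
  by move=> eE p; case: ifP => // /andP[/eqP-> /eqP->] [<-]; rewrite nc_flatE.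
move=> [tP t'P] p; rewrite nc_find_cat; case E: (nc_find (nc_rules t)) => [q|].
  by case=> <-; apply: IHt.
exact: IHt'.
Qed.

Lemma nc_stepE w p : nc_step (nc_rules rules) w = Some p ->
  nc_word w = nc_sum p.
Proof.
elim: w p => // i [|j w] IHw p //.
have -> : nc_step (nc_rules rules) [:: i, j & w] =
  match nc_find (nc_rules rules) i j with
  | Some p => Some (map (fun m => (m.1, m.2 ++ w)) p)
  | None =>
      omap (map (fun m => (m.1, i :: m.2))) (nc_step (nc_rules rules) (j :: w))
  end by exact: erefl.
case E: nc_find => [q|].
  case=> <-; rewrite /= mulrA (nc_findE E) /nc_sum big_map mulr_suml.
  by apply: eq_bigr => m _; rewrite /nc_value /= nc_word_cat mulrA.
case Ew: (nc_step _ (j :: w)) => [q|] //= [<-].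
rewrite -[_ * nc_word w]/(nc_word (j :: w)) (IHw q Ew) /nc_sum big_map mulr_sumr.
apply: eq_bigr => m _; rewrite /nc_value /=.
by case: m.1; rewrite ?(mulN1r, mulrN, mul1r).
Qed.

Lemma nc_normE fuel m acc :
  nc_sum (nc_norm (nc_rules rules) fuel m acc) = nc_value m + nc_sum acc.
Proof.
elim: fuel m acc => [|n IHn] m acc /=; first by rewrite /nc_sum big_cons.
case E: nc_step => [p|]; last exact: nc_insertE.
rewrite /nc_value (nc_stepE E).
elim: p {E} => [|m' p IHp] /=; first by rewrite /nc_sum big_nil mulr0 add0r.
rewrite IHn IHp addrA; congr (_ + _).
rewrite /nc_sum big_cons mulrDr; congr (_ + _).
by rewrite /nc_value /= signr_addb mulrA.
Qed.

Lemma nc_diff_eq fuel e f :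
  nc_diff rules fuel e f = [::] -> nc_eval e = nc_eval f.
Proof.
move=> dE; apply/eqP; rewrite -subr_eq0; apply/eqP.
have -> : nc_eval e - nc_eval f = nc_eval (NcAdd e (NcOpp f)) by [].
rewrite -nc_flatE -(big_nil 0 +%R xpredT nc_value) -/(nc_sum _) -dE /nc_diff.
elim: (nc_flat _) => [|m p IHp] //=.
by rewrite nc_normE /= -IHp /nc_sum big_cons.
Qed.

End NcSoundness.

Ltac nc_index x env :=
  lazymatch env with
  | x :: _ => constr:(0%N)
  | _ :: ?env' => let n := nc_index x env' in constr:(n.+1)
  end.

Ltac nc_reify env e :=
  lazymatch e with
  | (?a + ?b)%R =>
      let a' := nc_reify env a in let b' := nc_reify env b in
      constr:(NcAdd a' b')
  | (?a * ?b)%R =>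
      let a' := nc_reify env a in let b' := nc_reify env b in
      constr:(NcMul a' b')
  | (- ?a)%R => let a' := nc_reify env a in constr:(NcOpp a')
  | 0%R => constr:(NcZero)
  | 1%R => constr:(NcOne)
  | _ => let n := nc_index e env in constr:(NcVar n)
  end.

Ltac nc_reify_rules env T :=
  lazymatch T with
  | True => constr:(NcNil)
  | ?T1 /\ ?T2 =>
      let t1 := nc_reify_rules env T1 in
      let t2 := nc_reify_rules env T2 in
      constr:(NcNode t1 t2)
  | (?x * ?y = ?e)%R =>
      let i := nc_index x env in
      let j := nc_index y env in
      let e' := nc_reify env e in
      constr:(NcRule i j e')
  end.

(** The orientation matters: read as rewriting rules, these equations move the letters of [xs] to
    the left of those of [ys]. *)
Definition nc_comm (A : nzRingType) (xs ys : seq A) : Prop :=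
  foldr (fun x P => foldr (fun y Q => y * x = x * y /\ Q) True ys /\ P) True xs.

Lemma nc_commP (A : nzRingType) (xs ys : seq A) :
  {in xs & ys, forall x y, y * x = x * y} -> nc_comm xs ys.
Proof.
elim: xs => //= x xs IHxs xysC; split; last first.
  by apply: IHxs => x' y x'xs yys; rewrite xysC // inE x'xs orbT.
have : {in ys, forall y, y * x = x * y} by move=> y; apply: xysC; rewrite mem_head.
elim: ys {xysC IHxs} => //= y ys IHys yC; split; first exact/yC/mem_head.
by apply: IHys => y' y'ys; rewrite yC // inE y'ys orbT.
Qed.

(* [nc env pf] proves an equation between noncommutative polynomials in the
   letters [env]; [pf] proves a conjunction of rules [x * y = e], with [x] and [y]
   letters, which are oriented from left to right.  Confluence and termination
   are up to the user (each word is rewritten at most 200 times). *)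
Ltac nc env pf :=
  let T := type of pf in
  let T := eval cbv [nc_comm foldr] in T in
  let rs := nc_reify_rules env T in
  lazymatch goal with
  | |- ?a = ?b =>
      let a' := nc_reify env a in
      let b' := nc_reify env b in
      apply: (@nc_diff_eq _ env rs pf 200%N a' b');
      vm_compute; exact: erefl
  end.

(** * Exponentials and logarithms of formal power series *)

Section FpsMap.
Variables (K : comNzRingType) (A B : algType K) (f : {lrmorphism A -> B}).

Lemma fps_map_is_additive : zmod_morphism (fps_map f).
Proof. by move=> p q; apply: fpsP => n /=; rewrite rmorphB. Qed.
Lemma fps_map_is_multiplicative : monoid_morphism (fps_map f).
Proof.
split=> [|p q]; apply: fpsP => n /=; first by rewrite rmorph_nat.
by rewrite rmorph_sum; apply: eq_bigr => i _; rewrite rmorphM.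
Qed.
Lemma fps_map_is_scalable : scalable (fps_map f).
Proof. by move=> a p; apply: fpsP => n /=; rewrite linearZ. Qed.
HB.instance Definition _ :=
  GRing.isZmodMorphism.Build (fps A) (fps B) (fps_map f) fps_map_is_additive.
HB.instance Definition _ :=
  GRing.isMonoidMorphism.Build (fps A) (fps B) (fps_map f)
    fps_map_is_multiplicative.
HB.instance Definition _ :=
  GRing.isScalable.Build K (fps A) (fps B) *:%R (fps_map f) fps_map_is_scalable.

Lemma fps_mapD p q : fps_map f (p + q) = fps_map f p + fps_map f q.
Proof. exact: rmorphD. Qed.
Lemma fps_mapB p q : fps_map f (p - q) = fps_map f p - fps_map f q.
Proof. exact: rmorphB. Qed.
Lemma fps_mapN p : fps_map f (- p) = - fps_map f p.
Proof. exact: rmorphN. Qed.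
Lemma fps_mapM p q : fps_map f (p * q) = fps_map f p * fps_map f q.
Proof. exact: rmorphM. Qed.
Lemma fps_map1 : fps_map f 1 = 1.
Proof. exact: rmorph1. Qed.
Lemma fps_mapZ a p : fps_map f (a *: p) = a *: fps_map f p.
Proof. exact: linearZ. Qed.

Lemma fps_mapX : fps_map f 'xi = 'xi.
Proof. by apply: fpsP => n /=; rewrite rmorph_nat. Qed.

Lemma fps_mapC a : fps_map f (fpsC a) = fpsC (f a).
Proof. by apply: fpsP => n /=; case: ifP => _ //; rewrite rmorph0. Qed.

End FpsMap.

Section FpsCoef.
Variables (K : comNzRingType) (A : algType K).
Implicit Types (p q : fps A) (a b : A).

Lemma fps_coefM p q n : (p * q) n = \sum_(i < n.+1) p i * q (n - i)%N.
Proof. by []. Qed.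

Lemma fps_coefM_rev p q n : (p * q) n = \sum_(i < n.+1) p (n - i)%N * q i.
Proof. exact: fps_mul_rev. Qed.

Lemma fps_coefD p q n : (p + q) n = p n + q n. Proof. by []. Qed.
Lemma fps_coefN p n : (- p) n = - p n. Proof. by []. Qed.
Lemma fps_coefZ k p n : (k *: p) n = k *: p n. Proof. by []. Qed.

Lemma fps_coef_sum I (r : seq I) (P : pred I) (F : I -> fps A) n :
  (\sum_(i <- r | P i) F i) n = \sum_(i <- r | P i) F i n.
Proof. by elim/big_rec2: _ => // i x p _ <-. Qed.

Lemma fps_coefXM p n : ('xi * p) n = if n is m.+1 then p m else 0.
Proof.
rewrite fps_coefM; case: n => [|n]; first by rewrite big_ord1 mul0r.
rewrite 2!big_ord_recl big1 => [|i _]; last by rewrite mul0r.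
by rewrite mul0r mul1r add0r addr0 subn1.
Qed.

Lemma fps_coefMX p n : (p * 'xi) n = if n is m.+1 then p m else 0.
Proof.
rewrite fps_coefM_rev; case: n => [|n]; first by rewrite big_ord1 mulr0.
rewrite 2!big_ord_recl big1 => [|i _]; last by rewrite mulr0.
by rewrite mulr0 mulr1 add0r addr0 subn1.
Qed.

Lemma fps_XC p : p * 'xi = 'xi * p.
Proof. by apply: fpsP => n; rewrite fps_coefMX fps_coefXM. Qed.

Lemma fps_XI p q : 'xi * p = 'xi * q -> p = q.
Proof.
by move=> pq; apply: fpsP => n; have /(congr1 (fun r : fps A => r n.+1)) := pq;
  rewrite !fps_coefXM.
Qed.

Lemma fps_coefCM a p n : (fpsC a * p) n = a * p n.
Proof.
rewrite fps_coefM big_ord_recl big1 => [|i _]; last by rewrite mul0r.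
by rewrite addr0 subn0.
Qed.

Lemma fps_coefMC a p n : (p * fpsC a) n = p n * a.
Proof.
rewrite fps_coefM_rev big_ord_recl big1 => [|i _]; last by rewrite mulr0.
by rewrite addr0 subn0.
Qed.

Lemma fpsCM a b : fpsC (a * b) = fpsC a * fpsC b.
Proof.
by apply: fpsP => n; rewrite fps_coefCM /=; case: ifP => // _; rewrite mulr0.
Qed.

Lemma fpsCD a b : fpsC (a + b) = fpsC a + fpsC b.
Proof. by apply: fpsP => n /=; case: ifP => // _; rewrite addr0. Qed.

Lemma fpsCZ k a : fpsC (k *: a) = k *: fpsC a.
Proof. by apply: fpsP => n /=; case: ifP => // _; rewrite scaler0. Qed.

Lemma fpsC0 : fpsC 0 = 0 :> fps A.
Proof. by apply: fpsP => n /=; case: ifP. Qed.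

Lemma fps_coef0M p q : (p * q) 0 = p 0 * q 0.
Proof. by rewrite fps_coefM big_ord1. Qed.

End FpsCoef.

Section FpsCongruence.
Variables (K : comNzRingType) (A : algType K).
Implicit Types (p q : fps A) (N : nat).

(** Congruence modulo [xi ^+ N]; it reduces identities between exponentials to identities between
    finite sums. *)
Definition fps_eqmod N p q := forall i, (i < N)%N -> p i = q i.

Lemma fps_eqmod_mul N p p' q q' :
  fps_eqmod N p p' -> fps_eqmod N q q' -> fps_eqmod N (p * q) (p' * q').
Proof.
move=> pE qE n ltnN; rewrite !fps_coefM; apply: eq_bigr => i _.
rewrite pE 1?qE //; first exact: leq_ltn_trans (leq_subr _ _) ltnN.
by apply: leq_ltn_trans ltnN; rewrite -ltnS.
Qed.

Lemma fps_eqmod_mull N p q q' :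
  fps_eqmod N q q' -> fps_eqmod N (p * q) (p * q').
Proof. exact: fps_eqmod_mul. Qed.

Lemma fps_eqmod_mulr N p p' q :
  fps_eqmod N p p' -> fps_eqmod N (p * q) (p' * q).
Proof. by move=> pE; apply: fps_eqmod_mul. Qed.

Lemma fps_eqmodP p q : (forall N, fps_eqmod N p q) -> p = q.
Proof. by move=> pq; apply: fpsP => n; apply: pq (leqnn n.+1). Qed.

(** Without constant term [p] is a multiple of [xi], which is central, hence [p ^+ k] is a multiple
    of [xi ^+ k]. *)
Lemma fps_coefX_small p k n : p 0 = 0 -> (n < k)%N -> (p ^+ k) n = 0.
Proof.
move=> p0; elim: k n => // k IHk n lenk.
rewrite exprS fps_coefM big1 // => i _.
case: (posnP i) => [->|i_gt0]; first by rewrite p0 mul0r.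
rewrite IHk ?mulr0 // ltn_subLR; last by rewrite -ltnS.
by rewrite (leq_trans lenk) // -add1n leq_add2r.
Qed.

End FpsCongruence.

Section FpsExp.
Variables (K : fieldType) (A : algType K).
Implicit Types (p q x y z : fps A) (N : nat).

Definition fps_exp_trunc N p : fps A := \sum_(k < N) k`!%:R^-1 *: p ^+ k.

Lemma fps_exp_coef p N n : p 0 = 0 -> (n < N)%N ->
  fps_exp p n = fps_exp_trunc N p n.
Proof.
move=> p0 ltnN; rewrite /fps_exp_trunc fps_coef_sum /=.
rewrite (big_ord_widen N (fun k => k`!%:R^-1 *: (p ^+ k) n) ltnN) big_mkcond /=.
apply: eq_bigr => k _; case: ltnP => // ltnk.
by rewrite fps_coefX_small ?scaler0.
Qed.

Lemma fps_exp_eqmod N p : p 0 = 0 -> fps_eqmod N (fps_exp p) (fps_exp_trunc N p).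
Proof. by move=> p0 n; apply: fps_exp_coef. Qed.

Lemma fps_exp0 : fps_exp (0 : fps A) = 1.
Proof.
apply: fpsP => n /=; rewrite big_ord_recl big1 => [|i _].
  by rewrite expr0 fact0 invr1 scale1r addr0.
by rewrite expr0n /= scaler0.
Qed.

Lemma fps_exp_coef0 p : fps_exp p 0 = 1.
Proof. by rewrite /= big_ord1 fact0 invr1 scale1r. Qed.

(** The factors of [p ^+ k] pass [x] one at a time. Allowing [q] to differ from [p] covers the
    diagonal actions, where [q] is [p] plus a commuting term. *)
Lemma fps_exp_intertwine p q x : p 0 = 0 -> q 0 = 0 -> p * x = x * q ->
  fps_exp p * x = x * fps_exp q.
Proof.
move=> p0 q0 pxq; apply: fps_eqmodP => N n ltnN.
rewrite (fps_eqmod_mulr _ (fps_exp_eqmod p0) ltnN).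
rewrite (fps_eqmod_mull _ (fps_exp_eqmod q0) ltnN).
congr (fcoef _ _); rewrite mulr_suml mulr_sumr; apply: eq_bigr => k _.
rewrite -scalerAl -scalerAr; congr (_ *: _).
by elim: (k : nat) => [|m IHm]; rewrite ?mul1r ?mulr1 // exprSr -mulrA pxq mulrA IHm -mulrA -exprSr.
Qed.

Lemma fps_exp_comm p x : p 0 = 0 -> p * x = x * p ->
  fps_exp p * x = x * fps_exp p.
Proof. by move=> p0; apply: fps_exp_intertwine. Qed.

(** Leibniz rule for an adjoint action that vanishes at third order: [y] is the first commutator of
    [p] with [x] and [z] half of the second one, so the binomial coefficient of [z *+ 2] becomes
    [k * k.-1] and no division occurs. The truncated predecessors are harmless, since their terms
    have multiplicity 0. *)
Lemma exp_comm_pow2 (R : nzRingType) (p x y z : R) k :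
    p * x = x * p + y -> p * y = y * p + z *+ 2 -> p * z = z * p ->
  p ^+ k * x = x * p ^+ k + (y * p ^+ k.-1) *+ k
               + (z * p ^+ k.-2) *+ (k * k.-1).
Proof.
move=> px py pz; elim: k => [|k IHk].
  by rewrite !mulr0n mul1r mulr1 !addr0.
rewrite exprS -mulrA IHk !mulrDr !mulrA px !mulrnAr !mulrA py pz.
rewrite !mulrDl -!mulrA -!exprS.
case: k {IHk} => [|[|k]].
- by rewrite !mulr0n !addr0.
- change (x * p ^+ 2 + y * p ^+ 1 + (y * p ^+ 1 + (z * p ^+ 0 + z * p ^+ 0)) + 0 =
    x * p ^+ 2 + (y * p ^+ 1 + y * p ^+ 1) + (z * p ^+ 0 + z * p ^+ 0)).
  by rewrite addr0 !addrA.
set X := x * _; set Y := y * p ^+ k.+2; set Z := z * p ^+ k.+1.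
change (X + Y + (Y + (Z + Z)) *+ k.+2 + Z *+ (k.+2 * k.+1) =
        X + Y *+ k.+3 + Z *+ (k.+3 * k.+2)).
rewrite -mulr2n mulrnDl -mulrnA [Y *+ k.+3]mulrS.
have -> : (k.+3 * k.+2 = 2 * k.+2 + k.+2 * k.+1)%N by lia.
rewrite mulrnDr; move: (Y *+ k.+2) (Z *+ _) (Z *+ _) => a b d.
by rewrite !addrA.
Qed.

Hypothesis char0 : [pchar K] =i pred0.

(** This is [e^p x e^(-p) = e^(ad p) x] when the series on the right stops after the quadratic term,
    which is [z]. *)
Lemma fps_exp_conj2 p x y z : p 0 = 0 ->
    p * x = x * p + y -> p * y = y * p + z *+ 2 -> p * z = z * p ->
  fps_exp p * x = (x + y + z) * fps_exp p.
Proof.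
move=> p0 px py pz; apply: fps_eqmodP => N n ltnN.
have expE M := fps_eqmod_mulr x (@fps_exp_eqmod M p p0).
(* The terms in [y] and [z] carry the powers [k.-1] and [k.-2], so after the shift of the index
   their sums are one and two terms shorter. Truncating at [N.+2], [N.+1] and [N] makes the three
   sums match exactly. *)
rewrite (expE N.+2) ?(leq_trans ltnN) 1?ltnW //.
rewrite !mulrDl !fps_coefD.
have expE' M v : (N <= M)%N -> (v * fps_exp p) n = (v * fps_exp_trunc M p) n.
  move=> leNM; apply: (fps_eqmod_mull _ (fps_exp_eqmod (N := M) p0)).
  exact: leq_trans leNM.
rewrite (expE' N.+2) ?leqW // (expE' N.+1 y) // (expE' N z) //.
rewrite -!fps_coefD; congr (fcoef _ _).
rewrite /fps_exp_trunc mulr_suml.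
under eq_bigr => k _ do
  rewrite -scalerAl (exp_comm_pow2 k px py pz) !scalerDr.
rewrite !big_split /=; congr (_ + _ + _).
- by rewrite mulr_sumr; apply: eq_bigr => k _; rewrite scalerAr.
- rewrite big_ord_recl /= mulr0n scaler0 add0r mulr_sumr.
  apply: eq_bigr => k _; rewrite /= -scalerAr -scaler_nat scalerA; congr (_ *: _).
  by rewrite factS natrM invfM mulrC mulrA mulfV ?mul1r // ((pcharf0P K).1 char0).
- rewrite 2!big_ord_recl /= !mulr0n !scaler0 !add0r mulr_sumr.
  apply: eq_bigr => k _; rewrite /= -scalerAr -scaler_nat scalerA; congr (_ *: _).
  rewrite !factS mulnA natrM invfM mulrC mulrA mulfV ?mul1r //.
  by rewrite ((pcharf0P K).1 char0).
Qed.

(** Regroups the double sum of a product of two truncated exponentials by total degree, as the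
    binomial formula requires. *)
Lemma sum_triangle (V : zmodType) (H : nat -> nat -> V) N :
    (forall i j, (N <= i + j)%N -> H i j = 0) ->
  \sum_(i < N) \sum_(j < N) H i j = \sum_(k < N) \sum_(i < k.+1) H (k - i)%N i.
Proof.
move=> H0; transitivity (\sum_(j < N) \sum_(i < N - j) H i j).
  rewrite exchange_big; apply: eq_bigr => j _ /=.
  rewrite (big_ord_widen _ (fun i => H i j) (leq_subr j N)) [RHS]big_mkcond /=.
  by apply: eq_bigr => i _; case: ltnP => // leNij; rewrite H0 // addnC -leq_subLR.
elim: {H0} N => [|N IHN]; first by rewrite !big_ord0.
rewrite [RHS]big_ord_recr /= -IHN big_ord_recr /= subSnn big_ord1.
rewrite [X in _ = _ + X]big_ord_recr /= subnn addrA; congr (_ + _).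
rewrite -big_split; apply: eq_bigr => i _ /=.
by rewrite subSn 1?ltnW // big_ord_recr.
Qed.

Lemma fps_expD p q : p 0 = 0 -> q 0 = 0 -> p * q = q * p ->
  fps_exp (p + q) = fps_exp p * fps_exp q.
Proof.
move=> p0 q0 pq; apply: fpsP => n; have ltnN := leqnn n.+1.
have pq0 : (p + q) 0 = 0 by rewrite fps_coefD p0 q0 addr0.
rewrite (fps_exp_coef pq0 ltnN).
rewrite (fps_eqmod_mul (fps_exp_eqmod p0) (fps_exp_eqmod q0) ltnN).
pose H i j := (i`!%:R^-1 *: p ^+ i * (j`!%:R^-1 *: q ^+ j)) n.
rewrite /fps_exp_trunc mulr_suml [RHS]fps_coef_sum.
under [RHS]eq_bigr => i _ do rewrite mulr_sumr fps_coef_sum.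
rewrite (@sum_triangle _ H) => [|i j lenij]; last first.
  rewrite /H -scalerAl -scalerAr !fps_coefZ fps_coefM big1 ?scaler0 // => l _.
  (* Since [l + (n - l) = n < i + j], either [l < i] or [n - l < j], and one of the two coefficients
     vanishes. *)
  have [lti|gei] := ltnP l i; first by rewrite fps_coefX_small ?mul0r.
  rewrite (@fps_coefX_small _ _ q) ?mulr0 // ltn_subLR -1?ltnS //.
  by apply: leq_trans lenij _; rewrite leq_add2r.
rewrite fps_coef_sum; apply: eq_bigr => k _.
rewrite (exprDn_comm _ pq) scaler_sumr fps_coef_sum; apply: eq_bigr => i _.
rewrite /H -scalerAl -scalerAr scalerA -scaler_nat scalerA; congr (fcoef (_ *: _) _).
have leik : (i <= k)%N by rewrite -ltnS.
rewrite -(bin_fact leik) !natrM !invfM.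
have C0 : ('C(k, i))%:R != 0 :> K by rewrite ((pcharf0P K).1 char0) -lt0n bin_gt0.
by rewrite mulrAC mulVf // mul1r mulrC.
Qed.

Lemma fps_expNr p : p 0 = 0 -> fps_exp p * fps_exp (- p) = 1.
Proof.
move=> p0; rewrite -fps_expD ?subrr ?fps_exp0 // ?mulrN ?mulNr //.
by rewrite fps_coefN p0 oppr0.
Qed.

Lemma fps_expNl p : p 0 = 0 -> fps_exp (- p) * fps_exp p = 1.
Proof.
move=> p0; rewrite -{2}[p]opprK fps_expNr //.
by rewrite fps_coefN p0 oppr0.
Qed.

(** A product of at least two factors without constant term gains one order of precision. This
    drives the induction in [fps_exp_inj]. *)
Lemma fps_eqmodX p q N k : p 0 = 0 -> q 0 = 0 -> fps_eqmod N p q ->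
  fps_eqmod N.+1 (p ^+ k.+2) (q ^+ k.+2).
Proof.
move=> p0 q0 pq n ltnN; rewrite exprS [in RHS]exprS !fps_coefM.
(* The end terms [i = 0] and [i = n] contain a vanishing constant coefficient; in all others both
   [i] and [n - i] are below [N]. *)
apply: eq_bigr => i _; have [i0|i_gt0] := posnP i; first by rewrite i0 p0 q0 !mul0r.
have [iN|lti] := eqVneq (i : nat) n.
  by rewrite iN subnn !fps_coefX_small ?mulr0.
have ltin : (i < n)%N by rewrite ltn_neqAle lti -ltnS /=.
have ltiN : (i < N)%N by apply: leq_trans ltin _; rewrite -ltnS.
rewrite (pq _ ltiN); apply: congr1.
have {}pq : fps_eqmod N (p ^+ k.+1) (q ^+ k.+1).
  elim: k => [|k IHk]; first by rewrite !expr1.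
  by rewrite exprS [q ^+ _]exprS; apply: fps_eqmod_mul.
apply: pq; rewrite ltn_subLR; last exact: ltnW.
by rewrite (leq_trans ltnN) // -add1n leq_add2r.
Qed.

Definition fps_exp_tail p n : A := \sum_(k < n) k.+2`!%:R^-1 *: (p ^+ k.+2) n.

Lemma fps_exp_tail_eqmod p q N n : p 0 = 0 -> q 0 = 0 -> fps_eqmod N p q ->
  (n < N.+1)%N -> fps_exp_tail p n = fps_exp_tail q n.
Proof.
move=> p0 q0 pq ltnN; apply: eq_bigr => k _; apply: congr1.
exact: fps_eqmodX p0 q0 pq _ ltnN.
Qed.

Lemma fps_exp_coefSS p n : p 0 = 0 ->
  fps_exp p n = (1 : fps A) n + p n + fps_exp_tail p n.
Proof.
move=> p0; rewrite (@fps_exp_coef _ n.+2) // /fps_exp_trunc fps_coef_sum.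
by rewrite 2!big_ord_recl expr0 expr1 invr1 !scale1r addrA.
Qed.

(** For positive [n], coefficient [n] of the exponential is [p n] plus a tail that depends only on
    earlier coefficients of [p], so the coefficients are recovered one after the other. *)
Lemma fps_exp_inj p q : p 0 = 0 -> q 0 = 0 -> fps_exp p = fps_exp q -> p = q.
Proof.
move=> p0 q0 epq; apply: fps_eqmodP; elim=> // N IHN n ltnN.
have [-> //|n_gt0] := posnP n; first by rewrite p0 q0.
have : fps_exp p n = fps_exp q n by rewrite epq.
rewrite (fps_exp_coefSS n p0) (fps_exp_coefSS n q0).
by rewrite (fps_exp_tail_eqmod p0 q0 IHN ltnN) => /addIr/addrI.
Qed.

(** The Euler derivation [xi d/dxi]; unlike [d/dxi] it does not shift the index. *)
Definition fps_theta p : fps A := Fps (fun n => n%:R *: p n).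

Lemma fps_thetaM p q : fps_theta (p * q) = fps_theta p * q + p * fps_theta q.
Proof.
apply: fpsP => n; rewrite fps_coefD !fps_coefM /= scaler_sumr -big_split /=.
apply: eq_bigr => i _; rewrite -scalerAl -scalerAr -scalerDl -natrD subnKC //.
by rewrite -ltnS.
Qed.

Lemma fps_thetaX p k : p * fps_theta p = fps_theta p * p ->
  fps_theta (p ^+ k) = (fps_theta p * p ^+ k.-1) *+ k.
Proof.
move=> pC; elim: k => [|k IHk].
  rewrite mulr0n; apply: fpsP => [[|n]] /=; first by rewrite scale0r.
  by rewrite scaler0.
rewrite exprS fps_thetaM IHk mulrnAr mulrA pC -mulrA -exprS mulrS; congr (_ + _).
by case: k {IHk} => // k; rewrite !mulr0n.
Qed.

Lemma fps_theta_exp p : p 0 = 0 -> p * fps_theta p = fps_theta p * p ->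
  fps_theta (fps_exp p) = fps_theta p * fps_exp p.
Proof.
move=> p0 pC; apply: fps_eqmodP => N n ltnN.
rewrite (fps_eqmod_mull _ (fps_exp_eqmod p0) ltnN) [LHS]/=.
(* One term more than on the right: the derivation kills the term of index 0 and lowers the power in
   the others by one. *)
rewrite -[LHS]/(n%:R *: fps_exp p n) (@fps_exp_coef _ N.+1) 1?ltnW //.
rewrite -[LHS]/(fps_theta (fps_exp_trunc N.+1 p) n); congr (fcoef _ _).
have thetaD : {morph fps_theta : a b / a + b}.
  by move=> a b; apply: fpsP => i /=; rewrite scalerDr.
have theta0 : fps_theta 0 = 0 by apply: fpsP => i /=; rewrite scaler0.
rewrite (big_morph _ thetaD theta0) mulr_sumr.
have thetaZ k a : fps_theta (k *: a) = k *: fps_theta a.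
  by apply: fpsP => i /=; rewrite !scalerA mulrC.
under eq_bigr => k _ do rewrite thetaZ fps_thetaX // -scaler_nat scalerA.
rewrite big_ord_recl mulr0 scale0r add0r; apply: eq_bigr => k _.
rewrite -scalerAr [lift _ _ : nat]/= /bump add1n; congr (_ *: _).
by rewrite factS natrM invfM mulrAC mulVf ?mul1r // ((pcharf0P K).1 char0).
Qed.

Section Logarithm.
Variable E : A.
Let s := 1 + 'xi * fpsC E.
Let sigma := fps_ln s.

Lemma fps_ln_coef n : sigma n = ((-1) ^+ n.+1 / n%:R) *: E ^+ n.
Proof.
have pk k m : (('xi * fpsC E) ^+ k) m = (m == k)%:R * E ^+ k.
  elim: k m => [|k IHk] m; first by rewrite !expr0 mulr1.
  rewrite exprS -mulrA fps_coefXM; case: m => [|m]; first by rewrite mul0r.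
  rewrite fps_coefCM IHk eqSS exprS.
  by case: (m == k); rewrite ?mul1r // !mul0r mulr0.
rewrite /sigma /fps_ln /= /s addrC addKr.
under eq_bigr => k _ do rewrite pk.
rewrite big_ord_recr big1 /= => [|i _]; last first.
  by rewrite gtn_eqF // mul0r scaler0.
by rewrite eqxx mul1r add0r.
Qed.

Lemma fps_ln0 : sigma 0 = 0.
Proof. by rewrite fps_ln_coef invr0 mulr0 scale0r. Qed.

Lemma fps_comm_coef p q : (forall i j, p i * q j = q j * p i) -> p * q = q * p.
Proof.
move=> pq; apply: fpsP => n; rewrite fps_coefM fps_coefM_rev.
by apply: eq_bigr => i _; rewrite pq.
Qed.

Lemma fps_ln_comm_gen p : (forall i, p i * E = E * p i) -> p * sigma = sigma * p.
Proof.
move=> pE; apply: fps_comm_coef => i j; rewrite fps_ln_coef -scalerAr -scalerAl.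
by congr (_ *: _); apply: commrX.
Qed.

Lemma fps_exp_ln : fps_exp sigma = s.
Proof.
(* Both sides solve [s * theta f = xi * E * f], which determines f from f 0. *)
have thE p n : fps_theta p n = n%:R *: p n by [].
have sM p n : (s * p) n = p n + (if n is m.+1 then E * p m else 0).
  rewrite mulrDl mul1r fps_coefD -mulrA fps_coefXM; congr (_ + _).
  by case: n => // n; rewrite fps_coefCM.
have th : s * fps_theta sigma = 'xi * fpsC E.
  apply: fpsP => n; rewrite sM fps_coefXM.
  case: n => [|n]; first by rewrite /= scale0r addr0.
  rewrite !thE !fps_ln_coef !scalerA.
  rewrite mulrCA mulfV ?mulr1; last by rewrite ((pcharf0P K).1 char0).
  rewrite /=; case: n => [|n].
    by rewrite mul0r scale0r mulr0 addr0 expr1 sqrrN expr1n scale1r.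
  rewrite mulrCA mulfV ?mulr1; last by rewrite ((pcharf0P K).1 char0).
  by rewrite -scalerAr -exprS -scalerDl exprS mulN1r addNr scale0r.
have sC : sigma * fps_theta sigma = fps_theta sigma * sigma.
  symmetry; apply: fps_ln_comm_gen => i.
  rewrite -[fps_theta _ _]/(i%:R *: sigma i) fps_ln_coef.
  by rewrite -!scalerAl -!scalerAr -exprS -exprSr.
have fE n : (s * fps_theta (fps_exp sigma)) n.+1 = E * fps_exp sigma n.
  rewrite (fps_theta_exp fps_ln0 sC) mulrA th -mulrA fps_coefXM.
  by rewrite fps_coefCM.
have f0 : fps_exp sigma 0 = 1 by apply: fps_exp_coef0.
(* Comparing coefficients in the differential equation gives this recursion. Its factor [1 - n%:R]
   vanishes at [n = 1], which kills all coefficients from index 2 on. *)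
have fS n : fps_exp sigma n.+1 = n.+1%:R^-1 *: ((1 - n%:R) *: (E * fps_exp sigma n)).
  have := fE n; rewrite sM !thE => /(canRL (addrK _)) fn.
  rewrite scalerBl scale1r scalerAr -fn scalerA mulVf ?scale1r //.
  by rewrite ((pcharf0P K).1 char0).
have sE n : s n = if n is m.+1 then (if m is 0 then E else 0) else 1.
  have := sM 1 n; rewrite mulr1 => ->; case: n => [|[|n]] /=.
  - by rewrite addr0.
  - by rewrite mulr1 add0r.
  - by rewrite mulr0 add0r.
apply: fpsP => n; elim: n => [|[|n] IHn]; first by rewrite f0 sE.
  by rewrite fS f0 sE subr0 !scale1r invr1 scale1r mulr1.
rewrite fS {}IHn !sE; case: n => [|n]; first by rewrite subrr scale0r scaler0.
by rewrite mulr0 !scaler0.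
Qed.

(** The commutator with [y] is a derivation whose value [z] on [E] commutes with [E], so it sends
    [E ^+ n] to [n] times [E ^+ n.-1 * z]. The factor [n] cancels the denominator in the logarithm
    and leaves a geometric series, which multiplication by [s] collapses to [xi z]. *)
Lemma fps_ln_comm (y z : A) : y * E = E * y + z -> z * E = E * z ->
  fpsC y * sigma = sigma * fpsC y + fps_exp (- sigma) * ('xi * fpsC z).
Proof.
move=> yE zE; apply/eqP; rewrite addrC -subr_eq; apply/eqP.
set w := _ - _.
have yX n : y * E ^+ n = E ^+ n * y + (E ^+ n.-1 * z) *+ n.
  elim: n => [|n IHn]; first by rewrite mulr0n mul1r mulr1 addr0.
  rewrite exprSr mulrA IHn mulrDl -mulrA yE mulrDr mulrA -addrA; congr (_ + _).
  rewrite mulrnAl -mulrA zE mulrA mulrS; congr (_ + _).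
  by case: n {IHn} => // n; rewrite -exprSr.
have wE n : w n = if n is m.+1 then (-1) ^+ m *: (E ^+ m * z) else 0.
  rewrite /w fps_coefD fps_coefN fps_coefCM fps_coefMC fps_ln_coef.
  rewrite -scalerAr -scalerAl -scalerBr yX addrC addKr.
  case: n => [|n]; first by rewrite mulr0n scaler0.
  rewrite -scaler_nat scalerA mulfVK ?((pcharf0P K).1 char0) //=.
  by rewrite -[(-1) ^+ n.+2]mulr1 exprS exprS mulrA mulrNN !mul1r mulr1.
have sw : s * w = 'xi * fpsC z.
  apply: fpsP => n; rewrite mulrDl mul1r fps_coefD -mulrA !fps_coefXM.
  case: n => [|n]; first by rewrite wE addr0.
  rewrite fps_coefCM !wE /=; case: n => [|n].
    by rewrite mulr0 addr0 expr0 scale1r mul1r.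
  by rewrite -scalerAr mulrA -exprS -scalerDl exprS mulN1r addNr scale0r.
by rewrite -sw -fps_exp_ln mulrA fps_expNl ?mul1r // fps_ln0.
Qed.

End Logarithm.

End FpsExp.

Lemma fps_map_subst (K : fieldType) (A B : algType K) (f : {lrmorphism A -> B}) c p :
  fps_map f (fps_subst c p) = fps_subst c (fps_map f p).
Proof.
apply: fpsP => n /=; rewrite linear_sum; apply: eq_bigr => k _.
by rewrite -rmorphXn linearZ_LR.
Qed.

Lemma fps_map_exp (K : fieldType) (A B : algType K) (f : {lrmorphism A -> B}) p :
  fps_map f (fps_exp p) = fps_exp (fps_map f p).
Proof. exact: fps_map_subst. Qed.

Lemma fps_map_ln (K : fieldType) (A B : algType K) (f : {lrmorphism A -> B}) p :
  fps_map f (fps_ln p) = fps_ln (fps_map f p).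
Proof. by rewrite fps_map_subst rmorphB rmorph1. Qed.

(** * The twist in terms of generators and relations *)

(* The letters stand for [c = (3 gamma - 1) / 2], [xi], [u = e^(c sigma)],
   [s = e^sigma] and their inverses [ui], [si], [y = xi e23], [a = e12],
   [k = 2/3 hperp], [h], [b = e21], [g = e32].  There is no rule for [g * b]:
   [e31] is the commutator [g * b - b * g].  The scalar [c] is a letter because
   the normal forms of [nc] have integer coefficients. *)
Definition sl3_rels (B : nzRingType) (c xi u ui s si y a k h b g : B) : Prop :=
  (ui * u = 1 /\ u * ui = 1 /\ si * s = 1 /\ s * si = 1 /\
   s * u = u * s /\ s * ui = ui * s /\ si * u = u * si /\ si * ui = ui * si) /\
  nc_comm [:: u; ui; s; si] [:: y; a; k] /\
  (a * y = y * a + s - 1 /\ k * y = y * k - y /\ k * a = a * k + a) /\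
  (h * k = k * h /\
   h * u = u * h + c * (u - u * si) /\ h * ui = ui * h - c * (ui - ui * si) /\
   h * s = s * h + s - 1 /\ h * si = si * h - si + si * si /\
   h * y = y * h - c * y /\ h * a = a * h + c * a + a) /\
  (b * u = u * b + c * u * si * y /\ b * ui = ui * b - c * ui * si * y /\
   b * s = s * b + y /\ b * si = si * b - si * si * y /\ b * y = y * b /\
   b * a = a * b - h - k + c * k /\ b * k = k * b + b /\
   b * h = h * b + c * b + b) /\
  (g * u = u * g - c * xi * u * si * a /\ g * ui = ui * g + c * xi * ui * si * a /\
   g * s = s * g - xi * a /\ g * si = si * g + xi * si * si * a /\
   g * y = y * g - xi * (h - (c + 1 + 1) * k) /\ g * a = a * g /\
   g * k = k * g - g /\ g * h = h * g - c * g).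

Lemma sl3_rels_map (B T : nzRingType) (f : {rmorphism B -> T})
    (c xi u ui s si y a k h b g : B) :
  sl3_rels c xi u ui s si y a k h b g ->
  sl3_rels (f c) (f xi) (f u) (f ui) (f s) (f si) (f y) (f a) (f k) (f h) (f b) (f g).
Proof.
rewrite /sl3_rels /nc_comm /= => R.
repeat match goal with H : _ /\ _ |- _ => destruct H end.
repeat match goal with H : _ = _ |- _ =>
  apply (congr1 f) in H; rewrite !(rmorphM, rmorphD, rmorphB, rmorphN, rmorph1) in H
end.
repeat match goal with |- _ /\ _ => split end; assumption.
Qed.

Section TwistAlgebra.
Variable T : nzRingType.
Variables (c xi u1 ui1 s1 si1 y1 a1 k1 h1 b1 g1 : T).
Variables (u2 ui2 s2 si2 y2 a2 k2 h2 b2 g2 : T).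
Let left := [:: u1; ui1; s1; si1; y1; a1; k1; h1; b1; g1].
Let right := [:: u2; ui2; s2; si2; y2; a2; k2; h2; b2; g2].
(* The letters with index 1 and 2 stand for [x (x) 1] and [1 (x) x]. *)
Definition tensor_rels : Prop :=
  nc_comm [:: c; xi] left /\ nc_comm [:: c; xi] right /\ xi * c = c * xi /\
  nc_comm left right /\
  sl3_rels c xi u1 ui1 s1 si1 y1 a1 k1 h1 b1 g1 /\
  sl3_rels c xi u2 ui2 s2 si2 y2 a2 k2 h2 b2 g2.

(** On the left, a letter of weight [t] under [h] picks up [e^(t sigma)] on the right, with [t]
    equal to [- c], [1 + c], [- (1 + c)], [c] for [y], [a], [b], [g]. On the right, only the first
    commutator of [h (x) sigma] with the letter contributes. *)
Definition jordanian_rels (P : T) : Prop :=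
  nc_comm [:: c; xi] [:: P] /\
  (P * s1 = (1 + (s1 - 1) * s2) * P /\ P * y1 = y1 * ui2 * P /\ P * a1 = a1 * s2 * u2 * P /\
   P * k1 = k1 * P /\ P * h1 = h1 * P /\ P * b1 = b1 * si2 * ui2 * P /\
   P * g1 = g1 * u2 * P) /\
  (P * u2 = u2 * P /\ P * ui2 = ui2 * P /\ P * s2 = s2 * P /\ P * si2 = si2 * P /\
   P * y2 = y2 * P /\ P * a2 = a2 * P /\ P * k2 = k2 * P /\
   P * h2 = h2 * P - h1 * (1 - si2) * P /\
   P * b2 = b2 * P - h1 * si2 * y2 * P /\
   P * g2 = g2 * P + xi * h1 * si2 * a2 * P).

Definition extension_rels (Q : T) : Prop :=
  let q := a1 * y2 * u2 in
  nc_comm [:: c; xi] [:: Q] /\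
  (Q * s1 = s1 * Q /\ Q * y1 = (y1 + (s1 - 1) * y2 * u2) * Q /\ Q * a1 = a1 * Q /\
   Q * k1 = (k1 - q) * Q /\ Q * h1 = (h1 - (c + 1) * q) * Q /\
   Q * b1 = (b1 + (h1 + (1 - c) * k1) * y2 * u2 - a1 * y2 * u2 * y2 * u2) * Q /\
   Q * g1 = g1 * Q) /\
  (Q * u2 = u2 * Q /\ Q * ui2 = ui2 * Q /\ Q * s2 = s2 * Q /\ Q * si2 = si2 * Q /\
   Q * y2 = y2 * Q /\ Q * a2 = (a2 - a1 * (s2 - 1) * u2) * Q /\
   Q * k2 = (k2 + q) * Q /\ Q * h2 = (h2 + c * a1 * y2 * u2 * si2) * Q /\
   Q * b2 = (b2 - c * a1 * y2 * u2 * si2 * y2) * Q /\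
   Q * g2 = (g2 + a1 * (xi * (h2 - (c + 1 + 1) * k2) * u2
                        + c * xi * y2 * u2 * si2 * a2)
             + xi * a1 * a1 * (c * y2 * u2 * u2 * si2 - (c + 1) * y2 * u2 * u2)) * Q).

Hypothesis TR : tensor_rels.

Ltac nc_tensor :=
  let T := eval cbv [tensor_rels sl3_rels left right] in tensor_rels in
  nc [:: c; xi; u1; ui1; s1; si1; y1; a1; k1; h1; b1; g1;
      u2; ui2; s2; si2; y2; a2; k2; h2; b2; g2] (TR : T).

(** The twisted coproduct of [xi e23] times that of [e^(-sigma)]: the form needed for the generator
    [e23 e^(-sigma)]. *)
Lemma twist_y_normal :
  (y1 * ui2 + s1 * y2) * (si1 * si2) = y1 * si1 * (si2 * ui2) + y2 * si2.
Proof. nc_tensor. Qed.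

Section ExtensionRelations.
Variable Q : T.
Let q := a1 * y2 * u2.
Hypothesis conjQ : forall x y z,
  q * x = x * q + y -> q * y = y * q + (z + z) -> q * z = z * q ->
  Q * x = (x + y + z) * Q.

Let conj1Q x y : q * x = x * q + y -> q * y = y * q -> Q * x = (x + y) * Q.
Proof.
by move=> qx qy; rewrite (conjQ qx (z := 0)) ?addr0 ?mulr0 ?mul0r.
Qed.

Let commQ x : q * x = x * q -> Q * x = x * Q.
Proof. by move=> qx; rewrite (@conj1Q x 0) ?addr0 ?mulr0 ?mul0r. Qed.

(** The hypothesis [conjQ] contains all that is used about the exponential, so only commutators with
    [q] remain to be checked. The second commutator is nonzero for [b1] and [g2] only, hence the
    quadratic terms in these two rules. *)
Lemma extension_relsP : extension_rels Q.
Proof.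
rewrite /extension_rels /nc_comm /=; do !split; rewrite ?mulrA.
- by symmetry; rewrite commQ // /q; nc_tensor.
- by symmetry; rewrite commQ // /q; nc_tensor.
- by apply: commQ; rewrite /q; nc_tensor.
- by apply: conj1Q; rewrite /q; nc_tensor.
- by apply: commQ; rewrite /q; nc_tensor.
- by apply: conj1Q; rewrite /q; nc_tensor.
- by apply: conj1Q; rewrite /q; nc_tensor.
- by apply: conjQ; rewrite /q; nc_tensor.
- by apply: commQ; rewrite /q; nc_tensor.
- by apply: commQ; rewrite /q; nc_tensor.
- by apply: commQ; rewrite /q; nc_tensor.
- by apply: commQ; rewrite /q; nc_tensor.
- by apply: commQ; rewrite /q; nc_tensor.
- by apply: commQ; rewrite /q; nc_tensor.
- by apply: conj1Q; rewrite /q; nc_tensor.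
- by apply: conj1Q; rewrite /q; nc_tensor.
- by apply: conj1Q; rewrite /q; nc_tensor.
- by apply: conj1Q; rewrite /q; nc_tensor.
- by apply: conjQ; rewrite /q; nc_tensor.
Qed.
End ExtensionRelations.

Section TwistedCoproducts.
Variables P Q : T.
Hypothesis PR : jordanian_rels P.
Hypothesis QR : extension_rels Q.

Ltac nc_twist :=
  let T := eval cbv [tensor_rels jordanian_rels extension_rels sl3_rels left right] in
    (jordanian_rels P /\ extension_rels Q /\ tensor_rels) in
  nc [:: c; xi; u1; ui1; s1; si1; y1; a1; k1; h1; b1; g1;
      u2; ui2; s2; si2; y2; a2; k2; h2; b2; g2; P; Q]
   ((conj PR (conj QR TR)) : T).

Lemma twist_a : Q * P * (a1 + a2) = (a1 * u2 + a2) * (Q * P).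
Proof. nc_twist. Qed.
Lemma twist_h : Q * P * (h1 + h2) = (h1 * si2 + h2 - a1 * y2 * si2 * u2) * (Q * P).
Proof. nc_twist. Qed.
Lemma twist_k : Q * P * (k1 + k2) = (k1 + k2) * (Q * P).
Proof. nc_twist. Qed.
Lemma twist_s : Q * P * (s1 + s2 - 1) = s1 * s2 * (Q * P).
Proof. nc_twist. Qed.
Lemma twist_y : Q * P * (y1 + y2) = (y1 * ui2 + s1 * y2) * (Q * P).
Proof. nc_twist. Qed.
Lemma twist_b : Q * P * (b1 + b2) =
  (b1 * (si2 * ui2) + b2 + (1 - c) * k1 * y2 * si2) * (Q * P).
Proof. nc_twist. Qed.
Lemma twist_g : Q * P * (g1 + g2 - xi * ((h1 + h2) * (a1 + a2))) =
  ((g1 - xi * (h1 * a1)) * u2 + (g2 - xi * (h2 * a2)) - (c + 1 + 1) * xi * a1 * k2 * u2)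
   * (Q * P).
Proof. nc_twist. Qed.
(** Conjugation by [Q * P] is a ring morphism, so the coproduct of [e31 - xi h^2] is assembled from
    those already known. To this end the element is rewritten as the commutator of [g - xi h a] with
    [b], plus [xi] times a combination of [h k] and [b a]. *)
Lemma twist_e31 :
  let f1 := g1 * b1 - b1 * g1 in let f2 := g2 * b2 - b2 * g2 in
  Q * P * ((g1 + g2) * (b1 + b2) - (b1 + b2) * (g1 + g2)
           - xi * ((h1 + h2) * (h1 + h2))) =
  ((f1 - xi * (h1 * h1)) * si2 + (f2 - xi * (h2 * h2))
   + xi * a1 * b2 * u2 - (g1 - xi * (h1 * a1)) * (y2 * si2 * u2)
   - (1 + c + c) * xi * h1 * k2 * si2
   + (1 + c + c) * xi * a1 * k2 * y2 * si2 * u2) * (Q * P).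
Proof.
cbv zeta; set F := Q * P.
have FM x x' z z' : F * x = x' * F -> F * z = z' * F -> F * (x * z) = x' * z' * F.
  by move=> Fx Fz; rewrite mulrA Fx -mulrA Fz mulrA.
have FD x x' z z' : F * x = x' * F -> F * z = z' * F -> F * (x + z) = (x' + z') * F.
  by move=> Fx Fz; rewrite mulrDr Fx Fz mulrDl.
have FN x x' : F * x = x' * F -> F * - x = - x' * F.
  by move=> Fx; rewrite mulrN Fx mulNr.
have F1 : F * 1 = 1 * F by rewrite mulr1 mul1r.
have Fc : F * c = c * F by rewrite /F; nc_twist.
have Fxi : F * xi = xi * F by rewrite /F; nc_twist.
pose dg := g1 + g2 - xi * ((h1 + h2) * (a1 + a2)).
(* [h a, b] = h (h + (1 - c) k) - (1 + c) b a. *)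
have -> : (g1 + g2) * (b1 + b2) - (b1 + b2) * (g1 + g2) - xi * ((h1 + h2) * (h1 + h2))
  = dg * (b1 + b2) - (b1 + b2) * dg
    + xi * ((1 - c) * ((h1 + h2) * (k1 + k2)) - (1 + c) * ((b1 + b2) * (a1 + a2))).
  by rewrite /dg; nc_tensor.
rewrite (FD _ _ _ _ (FD _ _ _ _ (FM _ _ _ _ twist_g twist_b)
                       (FN _ _ (FM _ _ _ _ twist_b twist_g)))
                    (FM _ _ _ _ Fxi (FD _ _ _ _
                      (FM _ _ _ _ (FD _ _ _ _ F1 (FN _ _ Fc)) (FM _ _ _ _ twist_h twist_k))
                      (FN _ _ (FM _ _ _ _ (FD _ _ _ _ F1 Fc) (FM _ _ _ _ twist_b twist_a)))))).
by congr (_ * F); nc_tensor.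
Qed.
End TwistedCoproducts.
End TwistAlgebra.

(** * From Lie brackets to the commutation rules of the two exponentials *)

Section ExpCommutation.
Variables (K : fieldType) (A : algType K).
Hypothesis char0 : [pchar K] =i pred0.
Implicit Types (p q x y w : fps A).

Lemma fps_exp_conj1 p x y : p 0 = 0 -> p * x = x * p + y -> p * y = y * p ->
  fps_exp p * x = (x + y) * fps_exp p.
Proof.
move=> p0 px py; rewrite (@fps_exp_conj2 _ _ char0 p x y 0) ?addr0 //.
  by rewrite py mul0rn addr0.
by rewrite mulr0 mul0r.
Qed.

Lemma fps_coefZ0 a p : p 0 = 0 -> (a *: p) 0 = 0.
Proof. by move=> p0; rewrite fps_coefZ p0 scaler0. Qed.

Lemma fps_expZ_comm p a b : p 0 = 0 ->
  fps_exp (a *: p) * fps_exp (b *: p) = fps_exp (b *: p) * fps_exp (a *: p).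
Proof.
move=> p0; have ap0 := fps_coefZ0 a p0; have bp0 := fps_coefZ0 b p0.
by rewrite -!fps_expD ?[a *: p + _]addrC // -!scalerAl -!scalerAr !scalerA mulrC.
Qed.

Lemma fps_expZD p a b : p 0 = 0 ->
  fps_exp ((a + b) *: p) = fps_exp (a *: p) * fps_exp (b *: p).
Proof.
move=> p0; rewrite scalerDl fps_expD ?fps_coefZ0 //.
by rewrite -!scalerAl -!scalerAr !scalerA mulrC.
Qed.

(** Since [w] commutes with [p], conjugating [y] by [fps_exp (a *: p)] only subtracts [a *: w]. *)
Lemma mul_fps_exp p y w a : p 0 = 0 -> y * p = p * y + w -> w * p = p * w ->
  y * fps_exp (a *: p) = fps_exp (a *: p) * y + a *: (fps_exp (a *: p) * w).
Proof.
move=> p0 yp wp; have ap0 := fps_coefZ0 a p0.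
have wap : a *: p * w = w * (a *: p) by rewrite -scalerAl -wp scalerAr.
have ey : fps_exp (a *: p) * y = (y - a *: w) * fps_exp (a *: p).
  apply: fps_exp_conj1 => //.
    by rewrite -scalerAl -scalerAr yp scalerDr addrK.
  by rewrite mulrN mulNr -[in LHS]scalerAr wap scalerAl.
by rewrite ey (fps_exp_comm ap0 wap) scalerAl mulrDl mulNr subrK.
Qed.

End ExpCommutation.

Section LocalRelations.
Variables (K : fieldType) (U : algType K) (c : K).
Hypothesis char0 : [pchar K] =i pred0.
Variables e e23 a k h b g : U.

(** Here [e] is [e13], and the letters [a], [k], [b], [g] are as in [sl3_rels]. The coefficients
    [c + 1], [- c] come from [h13 + gamma hperp] acting on [e12] with weight [(3 gamma + 1) / 2] and
    on [e23] with weight [(1 - 3 gamma) / 2]. *)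
Definition sl3_brackets : Prop :=
  [/\ [/\ a * e = e * a, k * e = e * k, h * e = e * h + e, b * e = e * b + e23
        & g * e = e * g - a],
      [/\ e23 * e = e * e23, a * e23 = e23 * a + e, k * e23 = e23 * k - e23
        & k * a = a * k + a],
      [/\ h * k = k * h, h * e23 = e23 * h - c *: e23 & h * a = a * h + (c + 1) *: a],
      [/\ b * e23 = e23 * b, b * a = a * b - h - k + c *: k, b * k = k * b + b
        & b * h = h * b + (c + 1) *: b]
    & [/\ g * e23 = e23 * g - (h - (c + 2) *: k), g * a = a * g, g * k = k * g - g
        & g * h = h * g - c *: g]].

Hypothesis br : sl3_brackets.
Variable sigma : fps U.
Hypothesis sigma0 : sigma 0 = 0.
Hypothesis sigmaE : fps_exp sigma = 1 + 'xi * fpsC e.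
Hypothesis sigma_comm : forall x z, x * e = e * x + z -> z * e = e * z ->
  fpsC x * sigma = sigma * fpsC x + fps_exp (- sigma) * ('xi * fpsC z).
Let u := fps_exp (c *: sigma).
Let ui := fps_exp (- (c *: sigma)).
Let s := fps_exp sigma.
Let si := fps_exp (- sigma).
Let xi : fps U := 'xi.
Let cc : fps U := c%:A.

Let Cscal t (x : fps U) : t%:A * x = t *: x. Proof. exact: mulr_algl. Qed.

Lemma fpsCN (x : U) : fpsC (- x) = - fpsC x.
Proof. by rewrite -scaleN1r fpsCZ scaleN1r. Qed.

(** The commutator of [x] with [sigma] commutes with [sigma], so [mul_fps_exp] applies. The values
    [c], [- c], [1], [-1] of [t] give the rules for [u], [ui], [s], [si]. *)
Lemma fpsC_exp_sigma t v x z : fps_exp (t *: sigma) = v ->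
    x * e = e * x + z -> z * e = e * z ->
  fpsC x * v = v * fpsC x + t *: (v * (si * (xi * fpsC z))).
Proof.
move=> <- xe ze; apply: mul_fps_exp => //; first exact: sigma_comm.
have zs : fpsC z * sigma = sigma * fpsC z.
  by rewrite (@sigma_comm z 0) ?addr0 ?mul0r ?mulr0 // fpsC0 !mulr0 addr0.
have xz : xi * fpsC z * sigma = sigma * (xi * fpsC z).
  by rewrite -mulrA zs mulrA -(fps_XC sigma) -mulrA.
have sisig : si * sigma = sigma * si.
  by apply: fps_exp_comm; rewrite ?fps_coefN ?sigma0 ?oppr0 // mulNr mulrN.
by rewrite -mulrA xz mulrA sisig -mulrA.
Qed.

Definition exp_rels x z : Prop :=
  fpsC x * u = u * fpsC x + cc * (u * (si * (xi * z))) /\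
  fpsC x * ui = ui * fpsC x - cc * (ui * (si * (xi * z))) /\
  fpsC x * s = s * fpsC x + xi * z /\
  fpsC x * si = si * fpsC x - si * (si * (xi * z)).

Lemma exp_relsP x z :
  x * e = e * x + z -> z * e = e * z -> exp_rels x (fpsC z).
Proof.
move=> xe ze; split; [|split; [|split]].
- by rewrite (fpsC_exp_sigma (t := c) _ xe ze) // Cscal.
- by rewrite (fpsC_exp_sigma (t := - c) _ xe ze) ?scaleNr // Cscal.
- rewrite (fpsC_exp_sigma (t := 1) _ xe ze) ?scale1r // mulrA.
  by rewrite fps_expNr // mul1r.
- by rewrite (fpsC_exp_sigma (t := -1) _ xe ze) ?scaleN1r.
Qed.

Definition exp_inverse_rels : Prop :=
  ui * u = 1 /\ u * ui = 1 /\ si * s = 1 /\ s * si = 1 /\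
  s * u = u * s /\ s * ui = ui * s /\ si * u = u * si /\ si * ui = ui * si.

Lemma exp_inverse_relsP : exp_inverse_rels.
Proof.
have cs0 : (c *: sigma) 0 = 0 by apply: fps_coefZ0.
have comm t t' v v' : fps_exp (t *: sigma) = v -> fps_exp (t' *: sigma) = v' ->
    v * v' = v' * v by move=> <- <-; apply: fps_expZ_comm.
have uE : fps_exp (c *: sigma) = u by [].
have uiE : fps_exp (- c *: sigma) = ui by rewrite scaleNr.
have sE : fps_exp (1 *: sigma) = s by rewrite scale1r.
have siE : fps_exp (- 1 *: sigma) = si by rewrite scaleN1r.
do 4![split; first by [apply: fps_expNl | apply: fps_expNr]].
split; first exact: comm sE uE.
split; first exact: comm sE uiE.
split; first exact: comm siE uE.
exact: comm siE uiE.
Qed.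

Definition fpsC_sl3_brackets : Prop :=
  (xi * fpsC e = s - 1 /\ fpsC a * fpsC e = fpsC e * fpsC a
   /\ fpsC k * fpsC e = fpsC e * fpsC k) /\
  (fpsC a * fpsC e23 = fpsC e23 * fpsC a + fpsC e /\
   fpsC k * fpsC e23 = fpsC e23 * fpsC k - fpsC e23 /\
   fpsC k * fpsC a = fpsC a * fpsC k + fpsC a) /\
  (fpsC h * fpsC k = fpsC k * fpsC h /\
   fpsC h * fpsC e23 = fpsC e23 * fpsC h - cc * fpsC e23 /\
   fpsC h * fpsC a = fpsC a * fpsC h + (cc + 1) * fpsC a) /\
  (fpsC b * fpsC e23 = fpsC e23 * fpsC b /\
   fpsC b * fpsC a = fpsC a * fpsC b - fpsC h - fpsC k + cc * fpsC k /\
   fpsC b * fpsC k = fpsC k * fpsC b + fpsC b /\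
   fpsC b * fpsC h = fpsC h * fpsC b + (cc + 1) * fpsC b) /\
  (fpsC g * fpsC e23 = fpsC e23 * fpsC g - (fpsC h - (cc + 1 + 1) * fpsC k) /\
   fpsC g * fpsC a = fpsC a * fpsC g /\
   fpsC g * fpsC k = fpsC k * fpsC g - fpsC g /\
   fpsC g * fpsC h = fpsC h * fpsC g - cc * fpsC g).

Lemma fpsC_sl3_bracketsP : fpsC_sl3_brackets.
Proof.
have cc1 : cc + 1 = (c + 1)%:A by rewrite scalerDl scale1r.
have cc2 : cc + 1 + 1 = (c + 2)%:A by rewrite -[2]/(1 + 1) addrA !scalerDl scale1r.
case: br => [[r1 r2 _ _ _] [_ r3 r4 r5] [r6 r7 r8] [r9 r10 r11 r12] [r13 r14 r15 r16]].
rewrite /fpsC_sl3_brackets cc2 cc1 !Cscal -!fpsCM r1 r2 r3 r4 r5 r6 r7 r8 r9 r10.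
rewrite r11 r12 r13 r14 r15 r16 !(fpsCD, fpsCN, fpsCZ) -/s /s sigmaE addrC addKr.
by repeat match goal with |- _ /\ _ => split end.
Qed.

(** Here [e13] and [e23] are still separate letters; the rule [xi * fpsC e = s - 1] then eliminates
    [e13]. *)
Lemma fps_sl3_rels :
  sl3_rels cc xi u ui s si (xi * fpsC e23) (fpsC a) (fpsC k) (fpsC h) (fpsC b) (fpsC g).
Proof.
case: br => [[ae ke he be ge] [e23e _ _ _] _ _ _].
have R23 : exp_rels e23 0 by rewrite -fpsC0; apply: exp_relsP; rewrite ?addr0 ?mul0r ?mulr0.
have Ra : exp_rels a 0 by rewrite -fpsC0; apply: exp_relsP; rewrite ?addr0 ?mul0r ?mulr0.
have Rk : exp_rels k 0 by rewrite -fpsC0; apply: exp_relsP; rewrite ?addr0 ?mul0r ?mulr0.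
have Rh : exp_rels h (fpsC e) by apply: exp_relsP.
have Rb : exp_rels b (fpsC e23) by apply: exp_relsP.
have Rg : exp_rels g (- fpsC a).
  by rewrite -fpsCN; apply: exp_relsP; rewrite // mulNr mulrN ae.
have [e1 [e2 [e3 e4]]] : exp_rels e 0.
  by rewrite -fpsC0; apply: exp_relsP; rewrite ?addr0 ?mul0r ?mulr0.
have eC : nc_comm [:: fpsC e] [:: u; ui; s; si].
  rewrite !mulr0 addr0 in e1; rewrite !mulr0 subr0 in e2.
  rewrite !mulr0 addr0 in e3; rewrite !mulr0 subr0 in e4.
  exact: (conj (conj (esym e1) (conj (esym e2) (conj (esym e3) (conj (esym e4) I)))) I).
have central : nc_comm [:: cc; xi] [:: u; ui; s; si; fpsC e; fpsC e23; fpsC a; fpsC k;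
    fpsC h; fpsC b; fpsC g].
  apply: nc_commP => x y; rewrite !inE => /orP[]/eqP-> _; last exact: fps_XC.
  by rewrite mulr_algl mulr_algr.
have xc : xi * cc = cc * xi by rewrite mulr_algl mulr_algr.
have exps := exp_inverse_relsP; have brs := fpsC_sl3_bracketsP.
have all_rels := conj central (conj eC (conj xc (conj exps (conj brs
  (conj R23 (conj Ra (conj Rk (conj Rh (conj Rb Rg))))))))).
rewrite /exp_inverse_rels /fpsC_sl3_brackets /exp_rels in all_rels.
(* From here on the series are arbitrary letters, known only through the relations collected in
   [all_rels]. *)
clearbody cc xi u ui s si.
move: all_rels.
move: (fpsC e) (fpsC e23) (fpsC a) (fpsC k) (fpsC h) (fpsC b) (fpsC g).
clear.
move=> e e23 a k h b g R.
rewrite /sl3_rels /nc_comm /=.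
by repeat match goal with |- _ /\ _ => split end; try exact: I;
  nc [:: cc; xi; u; ui; s; si; e; e23; a; k; h; b; g] R.
Qed.
End LocalRelations.

Section TensorExp.
Variables (K : fieldType) (U V : algType K) (L R : {lrmorphism U -> V}).
Hypothesis char0 : [pchar K] =i pred0.
Hypothesis LRC : forall x y, R y * L x = L x * R y.
Local Notation l := (fps_map L).
Local Notation r := (fps_map R).
Implicit Types x y : fps U.

Lemma fps_map_comm x y : r y * l x = l x * r y.
Proof. by apply: fps_comm_coef => i j /=; rewrite LRC. Qed.

Variables h sigma : fps U.
Hypothesis sigma0 : sigma 0 = 0.
Let p := l h * r sigma.
Let p0 : p 0 = 0.
Proof. by rewrite fps_coef0M /= sigma0 rmorph0 mulr0. Qed.

Let lh_rsigma : l h * r sigma = r sigma * l h. Proof. by rewrite fps_map_comm. Qed.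

(** Moving [h (x) sigma] past [x (x) 1] adds [t] times [1 (x) sigma] to it; as the two summands
    commute, the exponential of the sum factors. *)
Lemma exp_tensor_left x t : h * x = x * h + t *: x ->
  fps_exp p * l x = l x * r (fps_exp (t *: sigma)) * fps_exp p.
Proof.
move=> hx; have tr0 : (t *: r sigma) 0 = 0 by rewrite fps_coefZ /= sigma0 rmorph0 scaler0.
have tp : t *: r sigma * p = p * (t *: r sigma).
  by rewrite -scalerAl -scalerAr mulrA -lh_rsigma.
have -> : r (fps_exp (t *: sigma)) = fps_exp (t *: r sigma).
  by rewrite fps_map_exp fps_mapZ.
rewrite -mulrA -fps_expD //; apply: fps_exp_intertwine => //.
  by rewrite fps_coefD tr0 p0 addr0.
rewrite /p -mulrA fps_map_comm mulrA -fps_mapM hx fps_mapD fps_mapZ mulrDl.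
by rewrite mulrDr addrC -scalerAl scalerAr fps_mapM mulrA.
Qed.

(** The commutator of [h (x) sigma] with [1 (x) y] is [- h (x) w], which commutes with
    [h (x) sigma], so the adjoint series stops at first order. *)
Lemma exp_tensor_right y w : y * sigma = sigma * y + w -> w * sigma = sigma * w ->
  fps_exp p * r y = (r y - l h * r w) * fps_exp p.
Proof.
move=> ys ws; apply: fps_exp_conj1 => //.
  rewrite /p -mulrA -fps_mapM (_ : sigma * y = y * sigma - w); last by rewrite ys addrK.
  by rewrite fps_mapB fps_mapM mulrBr !mulrA fps_map_comm.
rewrite mulrN mulNr; congr (- _); rewrite /p -!mulrA.
rewrite (mulrA (r _)) fps_map_comm (mulrA (r w)) (fps_map_comm h w) -!mulrA.
by rewrite -!fps_mapM ws.
Qed.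

End TensorExp.

Section TwistRelations.
Variables (K : fieldType) (U V : algType K) (L R : {lrmorphism U -> V}) (c : K).
Hypothesis char0 : [pchar K] =i pred0.
Hypothesis LRC : forall x y, R y * L x = L x * R y.
Local Notation l := (fps_map L).
Local Notation r := (fps_map R).
Variables e e23 a k h b g : U.
Hypothesis br : sl3_brackets c e e23 a k h b g.
Variable sigma : fps U.
Hypothesis sigma0 : sigma 0 = 0.
Hypothesis sigmaE : fps_exp sigma = 1 + 'xi * fpsC e.
Hypothesis sigma_comm : forall x z, x * e = e * x + z -> z * e = e * z ->
  fpsC x * sigma = sigma * fpsC x + fps_exp (- sigma) * ('xi * fpsC z).
Variables u ui s si y : fps U.
Hypothesis uE : fps_exp (c *: sigma) = u.
Hypothesis uiE : fps_exp (- (c *: sigma)) = ui.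
Hypothesis sE : fps_exp sigma = s.
Hypothesis siE : fps_exp (- sigma) = si.
Hypothesis yE : 'xi * fpsC e23 = y.

Let rels : sl3_rels c%:A 'xi u ui s si y
  (fpsC a) (fpsC k) (fpsC h) (fpsC b) (fpsC g).
Proof. rewrite -uE -uiE -sE -siE -yE.
exact: (fps_sl3_rels char0 br sigma0 sigmaE sigma_comm). Qed.

Definition fps_tensor_rels : Prop :=
  tensor_rels c%:A 'xi (l u) (l ui) (l s) (l si) (l y)
    (l (fpsC a)) (l (fpsC k)) (l (fpsC h)) (l (fpsC b)) (l (fpsC g))
    (r u) (r ui) (r s) (r si) (r y)
    (r (fpsC a)) (r (fpsC k)) (r (fpsC h)) (r (fpsC b)) (r (fpsC g)).

Lemma fps_map_scal (f : {lrmorphism U -> V}) : fps_map f c%:A = c%:A.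
Proof. by rewrite fps_mapZ fps_map1. Qed.

Lemma fps_tensor_relsP : fps_tensor_rels.
Proof.
have central (x t : fps V) : x \in [:: c%:A; 'xi] -> t * x = x * t.
  rewrite !inE => /orP[]/eqP->; last exact: fps_XC.
  by rewrite mulr_algl mulr_algr.
pose letters := [:: u; ui; s; si; y; fpsC a; fpsC k; fpsC h; fpsC b; fpsC g].
rewrite /fps_tensor_rels /tensor_rels; split; [|split; [|split; [|split; [|split]]]].
- by apply: nc_commP => x t xc _; apply: central.
- by apply: nc_commP => x t xc _; apply: central.
- by apply: central; rewrite mem_head.
- apply: (@nc_commP _ (map l letters) (map r letters)).
  by move=> _ _ /mapP[x _ ->] /mapP[z _ ->]; apply: fps_map_comm.
- rewrite -(fps_map_scal L) -(fps_mapX L); exact: (sl3_rels_map l rels).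
- rewrite -(fps_map_scal R) -(fps_mapX R); exact: (sl3_rels_map r rels).
Qed.

Let P := fps_exp (l (fpsC h) * r sigma).

Definition fps_jordanian_rels : Prop :=
  jordanian_rels c%:A 'xi (l s) (l y)
    (l (fpsC a)) (l (fpsC k)) (l (fpsC h)) (l (fpsC b)) (l (fpsC g))
    (r u) (r ui) (r s) (r si) (r y)
    (r (fpsC a)) (r (fpsC k)) (r (fpsC h)) (r (fpsC b)) (r (fpsC g)) P.

Lemma fps_jordanian_relsP : fps_jordanian_rels.
Proof.
have central (x t : fps V) : x \in [:: c%:A; 'xi] -> t * x = x * t.
  rewrite !inE => /orP[]/eqP->; last exact: fps_XC.
  by rewrite mulr_algl mulr_algr.
have cc x : c%:A * x = c *: x :> fps U by exact: mulr_algl.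
have [_ [_ [_ [[hk [hu [hui [hs [hsi [hy ha]]]]]] [[_ [_ [_ [_ [_ [_ [_ hb]]]]]]]
  [_ [_ [_ [_ [_ [_ [_ hg]]]]]]]]]]]] := rels.
have left x t v : fpsC h * x = x * fpsC h + t *: x -> fps_exp (t *: sigma) = v ->
    P * l x = l x * r v * P.
  by move=> hx <-; apply: exp_tensor_left.
have left0 x : fpsC h * x = x * fpsC h -> P * l x = l x * P.
  move=> hx; rewrite (@left x 0 1) ?scale0r ?fps_exp0 ?addr0 //.
  by rewrite fps_map1 mulr1.
have right x w : x * sigma = sigma * x + w -> w * sigma = sigma * w ->
    P * r x = (r x - l (fpsC h) * r w) * P.
  by move=> xs ws; apply: exp_tensor_right.
have right0 x : x * sigma = sigma * x -> P * r x = r x * P.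
  move=> xs; rewrite (@right x 0) ?addr0 ?mul0r ?mulr0 //.
  by rewrite (_ : r 0 = 0) ?mulr0 ?subr0 // rmorph0.
have exps t : fps_exp (t *: sigma) * sigma = sigma * fps_exp (t *: sigma).
  apply: fps_exp_comm; first exact: fps_coefZ0.
  by rewrite -scalerAl -scalerAr.
have Ccomm x : x * e = e * x -> fpsC x * sigma = sigma * fpsC x.
  by move=> xe; rewrite (@sigma_comm x 0) ?addr0 ?mul0r ?mulr0 // fpsC0 !mulr0 addr0.
have Xcomm x : fpsC x * sigma = sigma * fpsC x ->
    'xi * fpsC x * sigma = sigma * ('xi * fpsC x).
  by move=> xs; rewrite -mulrA xs mulrA -(fps_XC sigma) -mulrA.
have us : u * sigma = sigma * u by rewrite -uE; apply: exps.
have uis : ui * sigma = sigma * ui by rewrite -uiE -scaleNr; apply: exps.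
have ss : s * sigma = sigma * s by rewrite -sE -[X in fps_exp X]scale1r; apply: exps.
have sis : si * sigma = sigma * si.
  by rewrite -siE -[X in fps_exp X]scaleN1r; apply: exps.
have suE : fps_exp ((1 + c) *: sigma) = s * u.
  by rewrite fps_expZD // scale1r uE sE.
have siuiE : fps_exp (- (1 + c) *: sigma) = si * ui.
  by rewrite opprD fps_expZD // scaleN1r scaleNr uiE siE.
have uiE' : fps_exp (- c *: sigma) = ui by rewrite scaleNr.
have sis1 : si * s = 1 by rewrite -siE -sE fps_expNl.
case: br => [[ae ke he be ge] [e23e _ _ _] _ _ _].
(* As [[h, e13] = e13], the commutator is [e^(-sigma) xi e13], and [xi e13 = e^sigma - 1]. *)
have wh : fpsC h * sigma = sigma * fpsC h + (1 - si).
  rewrite (sigma_comm he) // siE (_ : 'xi * fpsC e = s - 1).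
    by rewrite mulrBr sis1 mulr1.
  by rewrite -sE sigmaE addrC addKr.
have ys : y * sigma = sigma * y by rewrite -yE; apply: Xcomm; apply: Ccomm.
have wb : fpsC b * sigma = sigma * fpsC b + si * y.
  by rewrite -yE -siE; apply: sigma_comm.
have as_ : fpsC a * sigma = sigma * fpsC a by apply: Ccomm.
have wg : fpsC g * sigma = sigma * fpsC g + - (si * ('xi * fpsC a)).
  by rewrite -siE (sigma_comm ge) ?mulNr ?mulrN ?ae // fpsCN !mulrN.
split; [|split; [do !split|do !split]].
- by apply: nc_commP => x t xc _; apply: central.
(* The series [s] is not a weight vector; its nonconstant part [xi e13] is one, of weight 1. *)
- have leq : P * l (fpsC e) = l (fpsC e) * r s * P.
    apply: (@left _ 1); last by rewrite scale1r.
    by rewrite scale1r -!fpsCM he fpsCD.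
  have sX : l s = 1 + 'xi * l (fpsC e).
    by rewrite -sE sigmaE fps_mapD fps_map1 fps_mapM fps_mapX.
  rewrite sX mulrDr mulr1 mulrA fps_XC -mulrA leq [1 + _ - 1]addrC addKr.
  by rewrite mulrDl mul1r -!mulrA.
- by apply: left uiE'; rewrite hy cc scaleNr.
- rewrite -[_ * r s * r u]mulrA -fps_mapM; apply: left suE.
  by rewrite ha cc scalerDl scale1r [fpsC a + _]addrC addrA.
- exact: left0.
- exact: left0.
- rewrite -[_ * r si * r ui]mulrA -fps_mapM; apply: left siuiE.
  by rewrite scaleNr scalerDl scale1r [fpsC b + _]addrC hb cc -[_ + _ + fpsC b]addrA addrK.
- by apply: left uE; rewrite hg cc subrK.
- exact: right0.
- exact: right0.
- exact: right0.
- exact: right0.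
- exact: right0.
- exact/right0/Ccomm.
- exact/right0/Ccomm.
- have wC : (1 - si) * sigma = sigma * (1 - si).
    by rewrite mulrBl mulrBr mul1r mulr1 sis.
  by rewrite (right _ _ wh wC) fps_mapB fps_map1 mulrBl.
- have wC : si * y * sigma = sigma * (si * y).
    by rewrite -mulrA ys mulrA sis -mulrA.
  by rewrite (right _ _ wb wC) fps_mapM mulrBl !mulrA.
- have wC : - (si * ('xi * fpsC a)) * sigma = sigma * - (si * ('xi * fpsC a)).
    rewrite mulNr mulrN; apply: congr1; rewrite -[LHS]mulrA Xcomm //.
    by rewrite [LHS]mulrA sis -[LHS]mulrA.
  rewrite (right _ _ wg wC) fps_mapN !fps_mapM fps_mapX mulrN opprK mulrDl.
  by rewrite !mulrA (fps_XC (_ * _)) !mulrA.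
Qed.

Lemma fps_extension_relsP :
  extension_rels c%:A 'xi (l s) (l y)
    (l (fpsC a)) (l (fpsC k)) (l (fpsC h)) (l (fpsC b)) (l (fpsC g))
    (r u) (r ui) (r s) (r si) (r y)
    (r (fpsC a)) (r (fpsC k)) (r (fpsC h)) (r (fpsC b)) (r (fpsC g))
    (fps_exp (l (fpsC a) * r y * r u)).
Proof.
apply: (extension_relsP fps_tensor_relsP) => x z w qx qz qw.
apply: fps_exp_conj2 => //.
by rewrite -mulrA fps_coef0M -fps_mapM -yE -mulrA /= big_ord1 mul0r rmorph0 mulr0.
Qed.

End TwistRelations.

(** * The special linear Lie algebra *)

Section SpecialLinearBrackets.
Variables (K : fieldType) (gamma : K).
Hypothesis char0 : [pchar K] =i pred0.
Let n2 : (2 : K) != 0. Proof. by rewrite ((pcharf0P K).1 char0). Qed.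
Let n3 : (3 : K) != 0. Proof. by rewrite ((pcharf0P K).1 char0). Qed.
Let h : sl K 3 := h13 + gamma *: hperp.
Let k : sl K 3 := (2 / 3) *: hperp.
Let c := 2^-1 * (3 * gamma - 1).
Let e : sl K 3 := e13.
Let e23' : sl K 3 := e23.
Let a : sl K 3 := e12.
Let b : sl K 3 := e21.
Let g : sl K 3 := e32.

Ltac bracket :=
  apply: val_inj; rewrite /= /c
    ?(mulmxDl, mulmxDr, mulmxBl, mulmxBr, mulmxN, mulNmx, =^~ scalemxAl, =^~ scalemxAr);
  rewrite ?mul_delta_mx_cond /= ?mulr1n ?mulr0n;
  apply/matrixP => i j; rewrite !mxE;
  field; rewrite ?n2 ?n3.

Lemma lieb_a_e : lieb a e = 0. Proof. by bracket. Qed.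
Lemma lieb_k_e : lieb k e = 0. Proof. by bracket. Qed.
Lemma lieb_h_e : lieb h e = e. Proof. by bracket. Qed.
Lemma lieb_b_e : lieb b e = e23'. Proof. by bracket. Qed.
Lemma lieb_g_e : lieb g e = - a. Proof. by bracket. Qed.
Lemma lieb_e23_e : lieb e23' e = 0. Proof. by bracket. Qed.
Lemma lieb_a_e23 : lieb a e23' = e. Proof. by bracket. Qed.
Lemma lieb_k_e23 : lieb k e23' = - e23'. Proof. by bracket. Qed.
Lemma lieb_k_a : lieb k a = a. Proof. by bracket. Qed.
Lemma lieb_h_k : lieb h k = 0. Proof. by bracket. Qed.
Lemma lieb_h_e23 : lieb h e23' = - (c *: e23'). Proof. by bracket. Qed.
Lemma lieb_h_a : lieb h a = (c + 1) *: a. Proof. by bracket. Qed.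
Lemma lieb_b_e23 : lieb b e23' = 0. Proof. by bracket. Qed.
Lemma lieb_b_a : lieb b a = - h - k + c *: k. Proof. by bracket. Qed.
Lemma lieb_b_k : lieb b k = b. Proof. by bracket. Qed.
Lemma lieb_b_h : lieb b h = (c + 1) *: b. Proof. by bracket. Qed.
Lemma lieb_g_e23 : lieb g e23' = - (h - (c + 2) *: k). Proof. by bracket. Qed.
Lemma lieb_g_a : lieb g a = 0. Proof. by bracket. Qed.
Lemma lieb_g_k : lieb g k = - g. Proof. by bracket. Qed.
Lemma lieb_g_h : lieb g h = - (c *: g). Proof. by bracket. Qed.
Lemma lieb_g_b : lieb g b = e31. Proof. by bracket. Qed.

Let X (x : sl K 3) : env (sl K 3) := env_in x.

Lemma env_in0 : X 0 = 0.
Proof. by rewrite -(scale0r (0 : sl K 3)) /X env_inZ scale0r. Qed.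

Lemma env_inN (x : sl K 3) : X (- x) = - X x.
Proof. by rewrite -scaleN1r /X env_inZ scaleN1r. Qed.

Lemma env_in_comm (x y z : sl K 3) : lieb x y = z -> X x * X y = X y * X x + X z.
Proof. by move=> <-; rewrite /X env_in_bracket addrC subrK. Qed.

Lemma env_sl3_brackets :
  sl3_brackets c (X e) (X e23') (X a) (X k) (X h) (X b) (X g).
Proof.
have XD (x y : sl K 3) : X (x + y) = X x + X y by apply: env_inD.
have XZ (t : K) (x : sl K 3) : X (t *: x) = t *: X x by apply: env_inZ.
split; split.
- by rewrite (env_in_comm lieb_a_e) env_in0 addr0.
- by rewrite (env_in_comm lieb_k_e) env_in0 addr0.
- by rewrite (env_in_comm lieb_h_e).
- by rewrite (env_in_comm lieb_b_e).
- by rewrite (env_in_comm lieb_g_e) ?(XD, env_inN, XZ) ?addrA.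
- by rewrite (env_in_comm lieb_e23_e) env_in0 addr0.
- by rewrite (env_in_comm lieb_a_e23).
- by rewrite (env_in_comm lieb_k_e23) ?(XD, env_inN, XZ) ?addrA.
- by rewrite (env_in_comm lieb_k_a).
- by rewrite (env_in_comm lieb_h_k) env_in0 addr0.
- by rewrite (env_in_comm lieb_h_e23) ?(XD, env_inN, XZ) ?addrA.
- by rewrite (env_in_comm lieb_h_a) ?(XD, env_inN, XZ) ?addrA.
- by rewrite (env_in_comm lieb_b_e23) env_in0 addr0.
- by rewrite (env_in_comm lieb_b_a) ?(XD, env_inN, XZ) ?addrA.
- by rewrite (env_in_comm lieb_b_k).
- by rewrite (env_in_comm lieb_b_h) ?(XD, env_inN, XZ) ?addrA.
- by rewrite (env_in_comm lieb_g_e23) ?(XD, env_inN, XZ) ?addrA.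
- by rewrite (env_in_comm lieb_g_a) env_in0 addr0.
- by rewrite (env_in_comm lieb_g_k) ?(XD, env_inN, XZ) ?addrA.
- by rewrite (env_in_comm lieb_g_h) ?(XD, env_inN, XZ) ?addrA.
Qed.

Lemma env_in_e31 : X e31 = X g * X b - X b * X g.
Proof. by rewrite (env_in_comm lieb_g_b) addrAC subrr add0r. Qed.

End SpecialLinearBrackets.

(** * The cocycle identity between products of exponentials *)

Section CocycleCore.
Variables (K : fieldType) (U W : algType K) (f1 f2 f3 : {lrmorphism U -> W}) (t : K).
Hypothesis char0 : [pchar K] =i pred0.
Hypothesis f12 : forall x y, f2 y * f1 x = f1 x * f2 y.
Hypothesis f13 : forall x y, f3 y * f1 x = f1 x * f3 y.
Hypothesis f23 : forall x y, f3 y * f2 x = f2 x * f3 y.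
Local Notation i1 := (fps_map f1).
Local Notation i2 := (fps_map f2).
Local Notation i3 := (fps_map f3).
Variables h a x sigma : fps U.
Hypothesis sigma0 : sigma 0 = 0.
Hypothesis ha : h * a = a * h + t *: a.
Hypothesis sigma_x : sigma * x = x * sigma.
Let v := fps_exp (t *: sigma).
Local Notation E := fps_exp.

(** For the twist, [x = e23 e^(c sigma)] and [t = 1 + c]. The factor [v] is created when
    [E (i1 h * i2 sigma)] passes [i1 a], which has weight [t]; all other exponentials that are split
    or exchanged have commuting exponents. *)
Lemma cocycle_core :
  E ('xi * (i1 a * i2 x)) * E (i1 h * i2 sigma) *
    (E ('xi * ((i1 a + i2 a) * i3 x)) * E ((i1 h + i2 h) * i3 sigma)) =
  E ('xi * (i1 a * (i2 x + i2 v * i3 x))) *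
    E (i1 h * (i2 sigma + i3 sigma)) *
    (E ('xi * (i2 a * i3 x)) * E (i2 h * i3 sigma)).
Proof.
have c12 p q : i2 q * i1 p = i1 p * i2 q by apply: fps_map_comm f12 _ _.
have c13 p q : i3 q * i1 p = i1 p * i3 q by apply: fps_map_comm f13 _ _.
have c23 p q : i3 q * i2 p = i2 p * i3 q by apply: fps_map_comm f23 _ _.
have vx : v * x = x * v.
  apply: fps_exp_comm; first exact: fps_coefZ0.
  by rewrite -scalerAl -scalerAr sigma_x.
have hv : E (i1 h * i2 sigma) * i1 a = i1 a * i2 v * E (i1 h * i2 sigma).
  exact: exp_tensor_left.
have X0 (p : fps W) : ('xi * p) 0 = 0 by rewrite fps_coefXM.
have S0 (f : {lrmorphism U -> W}) p : (p * fps_map f sigma) 0 = 0.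
  by rewrite fps_coef0M /= sigma0 rmorph0 mulr0.
have xiC (p : fps W) : p * 'xi = 'xi * p by exact: fps_XC.
have same (f : {lrmorphism U -> W}) p q : p * q = q * p ->
    fps_map f p * fps_map f q = fps_map f q * fps_map f p.
  by move=> pq; rewrite -!fps_mapM pq.
have xv2 : i2 x * i2 v = i2 v * i2 x by apply: same.
have sx3 : i3 sigma * i3 x = i3 x * i3 sigma by apply: same.
set xi : fps W := 'xi in X0 xiC *.
have central : nc_comm [:: xi] [:: i1 a; i1 h; i2 a; i2 h; i2 x; i2 v; i2 sigma; i3 x; i3 sigma].
  by apply: nc_commP => p q; rewrite inE => /eqP->.
have C12 : nc_comm [:: i1 a; i1 h] [:: i2 a; i2 h; i2 x; i2 v; i2 sigma].
  apply: (@nc_commP _ (map i1 [:: a; h]) (map i2 [:: a; h; x; v; sigma])).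
  by move=> _ _ /mapP[p _ ->] /mapP[q _ ->].
have C13 : nc_comm [:: i1 a; i1 h] [:: i3 x; i3 sigma].
  apply: (@nc_commP _ (map i1 [:: a; h]) (map i3 [:: x; sigma])).
  by move=> _ _ /mapP[p _ ->] /mapP[q _ ->].
have C23 : nc_comm [:: i2 a; i2 h; i2 x; i2 v; i2 sigma] [:: i3 x; i3 sigma].
  apply: (@nc_commP _ (map i2 [:: a; h; x; v; sigma]) (map i3 [:: x; sigma])).
  by move=> _ _ /mapP[p _ ->] /mapP[q _ ->].
have R := conj central (conj C12 (conj C13 (conj C23 (conj xv2 sx3)))).
have S2 := S0 f2; have S3 := S0 f3.
move: hv R X0 S2 S3; move: (i1 a) (i1 h) (i2 a) (i2 h) (i2 x) (i2 v) (i2 sigma) (i3 x) (i3 sigma).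
clearbody xi; clear -char0.
move=> a1 h1 a2 h2 x2 v2 s2 x3 s3 hv R X0 S2 S3.
rewrite [(a1 + a2) * x3]mulrDl [(h1 + h2) * s3]mulrDl !mulrDr.
rewrite (fps_expD char0 (X0 _) (X0 _));
  last by nc [:: xi; a1; h1; a2; h2; v2; x2; s2; x3; s3] R.
rewrite (fps_expD char0 (S3 _) (S3 _));
  last by nc [:: xi; a1; h1; a2; h2; v2; x2; s2; x3; s3] R.
rewrite (fps_expD char0 (X0 _) (X0 _));
  last by nc [:: xi; a1; h1; a2; h2; v2; x2; s2; x3; s3] R.
rewrite (fps_expD char0 (S2 _) (S3 _));
  last by nc [:: xi; a1; h1; a2; h2; v2; x2; s2; x3; s3] R.
have px : E (h1 * s2) * x3 = x3 * E (h1 * s2).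
  by apply: fps_exp_comm => //; nc [:: xi; a1; h1; a2; h2; v2; x2; s2; x3; s3] R.
have pxi : E (h1 * s2) * xi = xi * E (h1 * s2).
  by apply: fps_exp_comm => //; nc [:: xi; a1; h1; a2; h2; v2; x2; s2; x3; s3] R.
have pq : E (h1 * s2) * E (xi * (a1 * x3)) = E (xi * (a1 * (v2 * x3))) * E (h1 * s2).
  symmetry; apply: fps_exp_intertwine => //; symmetry.
  by rewrite mulrA pxi -mulrA (mulrA (E _)) hv -!mulrA px.
(* The exponents overlap in the third factor only, where [x] and [sigma] commute. *)
have qp : E (xi * (a2 * x3)) * E (h1 * s3) = E (h1 * s3) * E (xi * (a2 * x3)).
  apply: (fps_exp_comm (X0 _)); symmetry; apply: (fps_exp_comm (S3 _)).
  by nc [:: xi; a1; h1; a2; h2; v2; x2; s2; x3; s3] R.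
move: (E (xi * (a1 * x2))) (E (h1 * s2)) (E (xi * (a1 * x3))) (E (xi * (a2 * x3)))
  (E (h1 * s3)) (E (h2 * s3)) (E (xi * (a1 * (v2 * x3)))) pq qp.
move=> q12 p12 q13 q23 p13 p23 q123 pq qp.
by rewrite -!mulrA (mulrA p12) pq -!mulrA (mulrA q23) qp -!mulrA.
Qed.
End CocycleCore.

Lemma fps_tmulE (K : comNzRingType) (A B : augAlgType K) (p : fps A) (q : fps B) :
  p \ox q = fps_map (tens_inl B) p * fps_map (tens_inr A) q.
Proof.
apply: fpsP => n; rewrite fps_coefM /=; apply: eq_bigr => i _.
by rewrite /tens_inl /tens_inr tmulM mulr1 mul1r.
Qed.

Lemma fps_invP (K : fieldType) (A : algType K) (p q : fps A) :
  p * q = 1 -> q * p = 1 -> p * fps_inv p = 1 /\ fps_inv p * p = 1.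
Proof.
move=> pq qp.
by apply: (@xgetPex _ 1 [set q | p * q = 1 /\ q * p = 1]%classic); exists q.
Qed.

(** The inverse in [twisted_coprod] is chosen, not computed. The intertwining form removes it from
    all later calculations. *)
Lemma twisted_coprodP (K : fieldType) (L : lieAlgType K) (F G : fps (tens (env L) (env L))) x y :
  F * G = 1 -> G * F = 1 -> F * fps_map (coprod L) x = y * F ->
  twisted_coprod F x = y.
Proof.
move=> FG GF Fx; have [FI _] := fps_invP FG GF.
by rewrite /twisted_coprod Fx -mulrA FI mulr1.
Qed.

Lemma mul_inverse (R : nzRingType) (p q p' q' : R) :
  p * p' = 1 -> q * q' = 1 -> q * p * (p' * q') = 1.
Proof. by move=> pp qq; rewrite -mulrA (mulrA p) pp mul1r. Qed.

(** * Twisted coproducts of the generators *)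

Section TwistedGenerators.
Variables (K : fieldType) (gamma : K) (U V : algType K).
Variables (lf rf df : {lrmorphism U -> V}).
Local Notation l := (fps_map lf).
Local Notation r := (fps_map rf).
Local Notation D := (fps_map df).
Hypothesis char0 : [pchar K] =i pred0.
Hypothesis LRC : forall x z, rf z * lf x = lf x * rf z.
Let c := 2^-1 * (3 * gamma - 1).
Variables h k a b g e' e hp u ui s si : fps U.
Let y := 'xi * e'.
Variables P Q : fps V.
Let F := Q * P.
Hypothesis TR : tensor_rels c%:A 'xi (l u) (l ui) (l s) (l si) (l y)
    (l a) (l k) (l h) (l b) (l g) (r u) (r ui) (r s) (r si) (r y)
    (r a) (r k) (r h) (r b) (r g).
Hypothesis PR : jordanian_rels c%:A 'xi (l s) (l y)
    (l a) (l k) (l h) (l b) (l g) (r u) (r ui) (r s) (r si) (r y)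
    (r a) (r k) (r h) (r b) (r g) P.
Hypothesis QR : extension_rels c%:A 'xi (l s) (l y)
    (l a) (l k) (l h) (l b) (l g) (r u) (r ui) (r s) (r si) (r y)
    (r a) (r k) (r h) (r b) (r g) Q.
Hypotheses (Dh : D h = l h + r h) (Dk : D k = l k + r k) (Da : D a = l a + r a)
  (Db : D b = l b + r b) (Dg : D g = l g + r g) (De' : D e' = l e' + r e')
  (De : D e = l e + r e).
Hypothesis sE : s = 1 + 'xi * e.
Hypothesis hpE : hp = (3 / 2) *: k.
Hypotheses (sis : si * s = 1) (ssi : s * si = 1).

Let n2 : (2 : K) != 0. Proof. by rewrite ((pcharf0P K).1 char0). Qed.
Let xiC (p : fps V) : p * 'xi = 'xi * p. Proof. exact: fps_XC. Qed.
Let ry : r y = 'xi * r e'. Proof. by rewrite fps_mapM fps_mapX. Qed.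
Let ly : l y = 'xi * l e'. Proof. by rewrite fps_mapM fps_mapX. Qed.

Lemma twist_coprod_h : F * D h =
  (l h * r si + l 1 * r h - 'xi * (l a * r (e' * si * u))) * F.
Proof.
rewrite Dh (twist_h TR PR QR); congr (_ * _).
by rewrite ry !fps_map1 mul1r !fps_mapM !mulrA xiC.
Qed.

Lemma twist_coprod_a : F * D a = (l a * r u + l 1 * r a) * F.
Proof. by rewrite Da (twist_a TR PR QR) fps_map1 mul1r. Qed.

Lemma twist_coprod_hp : F * D hp = (l hp * r 1 + l 1 * r hp) * F.
Proof.
rewrite hpE !fps_mapZ Dk -scalerAr (twist_k TR PR QR) !fps_map1 mul1r mulr1.
by rewrite -scalerDr scalerAl.
Qed.

Lemma twist_coprod_s : F * D s = l s * r s * F.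
Proof.
rewrite -(twist_s TR PR QR); congr (_ * _).
rewrite sE !(fps_mapD, fps_mapM, fps_mapX, fps_map1) De mulrDr.
by rewrite -[RHS]addrA [1 + _ - 1]addrC addKr addrA.
Qed.

(** The rules for [P] do not cover [si (x) 1]. Instead the formula for [s] is inverted:
    [l si * r si] is a left inverse of [l s * r s], and [D si] a right inverse of [D s]. *)
Lemma twist_coprod_si : F * D si = l si * r si * F.
Proof.
have E1 : l si * r si * (l s * r s) = 1.
  rewrite -mulrA (mulrA (r si)) (fps_map_comm LRC) -mulrA -fps_mapM sis.
  by rewrite fps_map1 mulr1 -fps_mapM sis fps_map1.
have E2 : D s * D si = 1 by rewrite -fps_mapM ssi fps_map1.
rewrite -[LHS]mul1r -E1 -[LHS]mulrA; congr (_ * _).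
by rewrite mulrA -twist_coprod_s -mulrA E2 mulr1.
Qed.

Lemma twist_coprod_e23 : F * D (e' * si) =
  (l (e' * si) * r (si * ui) + l 1 * r (e' * si)) * F.
Proof.
(* [xi] is not a zero divisor, and the twisted coproduct of [xi e23] is known. *)
apply: fps_XI; rewrite fps_mapM De'.
have Fy : F * ('xi * (l e' + r e')) = (l y * r ui + l s * r y) * F.
  by rewrite mulrDr -ly -ry (twist_y TR PR QR).
have -> : 'xi * (F * ((l e' + r e') * D si)) = (l y * r ui + l s * r y) * (l si * r si) * F.
  rewrite -[RHS]mulrA -twist_coprod_si [RHS]mulrA -Fy.
  by rewrite !mulrA xiC !mulrA.
rewrite [RHS]mulrA; congr (_ * _).
rewrite (twist_y_normal TR) ly ry fps_map1 mul1r !fps_mapM mulrDr.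
by rewrite !mulrA.
Qed.

Lemma twist_coprod_b : F * D b =
  (l b * r (si * ui) + l 1 * r b + (1 - gamma) *: ('xi * (l hp * r (e' * si)))) * F.
Proof.
rewrite Db (twist_b TR PR QR); congr (_ * _).
rewrite ry hpE fps_map1 mul1r !fps_mapM !fps_mapZ -!scalerAl -!scalerAr scalerA.
(* The factor [3 / 2] comes from [hperp = 3/2 k]. In the same way [c + 2] and [1 + 2 c] become
   [gamma + 1] and [2 gamma] for the other generators. *)
have -> : (1 - gamma) * (3 / 2) = 1 - c by rewrite /c; field.
have -> : 1 - c%:A = (1 - c)%:A :> fps V by rewrite scalerBl scale1r.
congr (_ + _); rewrite mulr_algl -!scalerAl.
by congr (_ *: _); rewrite !mulrA xiC.
Qed.

Lemma twist_coprod_g : F * D (g - 'xi * (h * a)) =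
  (l (g - 'xi * (h * a)) * r u + l 1 * r (g - 'xi * (h * a))
   - (gamma + 1) *: ('xi * (l a * r (hp * u)))) * F.
Proof.
rewrite fps_mapB (fps_mapM df 'xi) fps_mapX (fps_mapM df h) Dg Dh Da.
rewrite (twist_g TR PR QR); congr (_ * _).
rewrite hpE !fps_mapB fps_map1 mul1r !fps_mapM !fps_mapX !fps_mapZ.
rewrite -!scalerAl -!scalerAr scalerA.
have -> : (gamma + 1) * (3 / 2) = c + 2 by rewrite /c; field.
have -> : c%:A + 1 + 1 = (c + 2)%:A :> fps V.
  by rewrite -[2]/(1 + 1) addrA !scalerDl scale1r.
congr (_ - _); rewrite mulr_algl -!scalerAl.
by congr (_ *: _); rewrite !mulrA.
Qed.

Lemma twist_coprod_f :
  F * D (g * b - b * g - 'xi * h ^+ 2) =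
  (l (g * b - b * g - 'xi * h ^+ 2) * r si + l 1 * r (g * b - b * g - 'xi * h ^+ 2)
   + 'xi * (l a * r (b * u))
   - 'xi * (l (g - 'xi * (h * a)) * r (e' * si * u))
   - (2 * gamma) *: ('xi * (l h * r (hp * si)))
   + (2 * gamma) *: ('xi ^+ 2 * (l a * r (hp * (e' * si) * u)))) * F.
Proof.
have dE : D (g * b - b * g - 'xi * h ^+ 2) =
    (l g + r g) * (l b + r b) - (l b + r b) * (l g + r g)
    - 'xi * ((l h + r h) * (l h + r h)).
  rewrite expr2 !fps_mapB (fps_mapM df g) (fps_mapM df b) (fps_mapM df 'xi) fps_mapX.
  by rewrite (fps_mapM df h) Dg Dh Db.
rewrite dE (twist_e31 TR PR QR); congr (_ * _).
have lE (f : {lrmorphism U -> V}) : fps_map f (g * b - b * g - 'xi * h ^+ 2) =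
    fps_map f g * fps_map f b - fps_map f b * fps_map f g
    - 'xi * (fps_map f h * fps_map f h) :> fps V.
  by rewrite expr2 !fps_mapB !fps_mapM fps_mapX.
rewrite !lE fps_map1 mul1r ry hpE.
have -> : 1 + c%:A + c%:A = (1 + c + c)%:A :> fps V by rewrite !scalerDl scale1r.
have gE : (2 * gamma) * (3 / 2) = 1 + c + c by rewrite /c; field.
rewrite !fps_mapM !fps_mapB !fps_mapM !fps_mapX !fps_mapZ.
rewrite !mulr_algl -!scalerAl -!scalerAr !scalerA gE expr2.
congr (_ + _ + _ - _ - _ + _).
- by rewrite !mulrA.
- have xiCA p q : p * ('xi * q) = 'xi * (p * q) :> fps V by rewrite mulrA xiC -mulrA.
  by rewrite -!(mulrA 'xi) xiCA !mulrA.
- by rewrite !mulrA.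
- by rewrite !mulrA xiC !mulrA.
Qed.

End TwistedGenerators.

Lemma fps_map_comp (A B C : Type) (f : A -> B) (f' : B -> C) (f'' : A -> C) (p : fps A) :
  (forall x, f' (f x) = f'' x) -> fps_map f' (fps_map f p) = fps_map f'' p.
Proof. by move=> ff; apply: fpsP => n /=. Qed.

(** Made for the counit conditions: a counit applied to one tensor factor kills both exponents. *)
Lemma fps_map_exp_mul_eq1 (K : fieldType) (A B : algType K) (f : {lrmorphism A -> B})
    (x z p q : fps A) :
  fps_map f x = 0 \/ fps_map f z = 0 -> fps_map f p = 0 \/ fps_map f q = 0 ->
  fps_map f (fps_exp ('xi * (x * z)) * fps_exp (p * q)) = 1.
Proof.
move=> xz pq; rewrite fps_mapM !fps_map_exp !fps_mapM.
have -> : fps_map f x * fps_map f z = 0 by case: xz => ->; rewrite ?mul0r ?mulr0.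
have -> : fps_map f p * fps_map f q = 0 by case: pq => ->; rewrite ?mul0r ?mulr0.
by rewrite mulr0 !fps_exp0 mulr1.
Qed.

Section ExpConj.
Variables (K : fieldType) (A : algType K).
Hypothesis char0 : [pchar K] =i pred0.

(** The conjugate [X = F p F^-1] again has no constant term, and its exponential is the conjugate of
    that of [p]; hence [X] and [q] have equal exponentials. *)
Lemma fps_exp_conj_inj (F G p q : fps A) : p 0 = 0 -> q 0 = 0 ->
  F * G = 1 -> G * F = 1 -> F * fps_exp p = fps_exp q * F -> F * p = q * F.
Proof.
move=> p0 q0 FG GF Fe; pose X := F * p * G.
have XF : X * F = F * p by rewrite /X -mulrA GF mulr1.
have X0 : X 0 = 0 by rewrite /X !fps_coef0M p0 mulr0 mul0r.
have eX : fps_exp X * F = fps_exp q * F by rewrite (fps_exp_intertwine X0 p0 XF).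
rewrite -XF; congr (_ * _); apply: fps_exp_inj => //.
by rewrite -[LHS]mulr1 -FG mulrA eX -mulrA FG mulr1.
Qed.

Lemma fps_ln1 : fps_ln (1 : fps A) = 0.
Proof.
apply: fpsP => n; rewrite /fps_ln /= subrr big1 // => -[[|k] lt] _ /=.
  by rewrite invr0 mulr0 scale0r.
by rewrite expr0n /= scaler0.
Qed.
End ExpConj.

Section SigmaCoproduct.
Variables (K : fieldType) (U V : algType K) (lf rf df : {lrmorphism U -> V}) (c : K).
Local Notation l := (fps_map lf).
Local Notation r := (fps_map rf).
Local Notation D := (fps_map df).
Hypothesis char0 : [pchar K] =i pred0.
Hypothesis LRC : forall x z, rf z * lf x = lf x * rf z.
Variables (F G : fps V) (sigma e' s si u ui : fps U).
Hypotheses (FG : F * G = 1) (GF : G * F = 1).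
Hypothesis sigma0 : sigma 0 = 0.
Hypotheses (uE : fps_exp (c *: sigma) = u) (sE : fps_exp sigma = s).
Hypothesis Fs : F * D s = l s * r s * F.

Let lr p q : r q * l p = l p * r q. Proof. exact: fps_map_comm. Qed.

Lemma twist_coprod_sigma : F * D sigma = (l sigma * r 1 + l 1 * r sigma) * F.
Proof.
have f0 (f : {lrmorphism U -> V}) : fps_map f sigma 0 = 0 by rewrite /= sigma0 rmorph0.
rewrite !fps_map1 mulr1 mul1r; apply: fps_exp_conj_inj FG GF _ => //.
  by rewrite fps_coefD !f0 addr0.
rewrite -fps_map_exp sE Fs (fps_expD char0 (f0 _) (f0 _)) ?lr //.
by rewrite -!fps_map_exp sE.
Qed.

(** No rule moves [P] past [u (x) 1]; the formula follows by exponentiating [c] times the primitive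
    coproduct of [sigma]. *)
Lemma twist_coprod_u : F * D u = l u * r u * F.
Proof.
have f0 (f : {lrmorphism U -> V}) : fps_map f (c *: sigma) 0 = 0.
  by rewrite /= sigma0 scaler0 rmorph0.
rewrite -uE !fps_map_exp -(fps_expD char0 (f0 _) (f0 _)) ?lr //.
symmetry; apply: fps_exp_intertwine; rewrite ?fps_coefD ?f0 ?addr0 //.
have := twist_coprod_sigma; rewrite !fps_map1 mulr1 mul1r => Fsig.
by rewrite !fps_mapZ -scalerDr -scalerAl -Fsig scalerAr.
Qed.

Hypotheses (sis : si * s = 1) (uui : ui * u = 1) (uis : ui * s = s * ui).
Hypothesis Fe : F * D (e' * si) = (l (e' * si) * r (si * ui) + l 1 * r (e' * si)) * F.

(** Write [e' * u] as the skew-primitive element [e' * si] times the group-like element [s * u]. The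
    right-hand factor [si * ui] in the first summand is cancelled exactly by [s * u]. *)
Lemma twist_coprod_x : F * D (e' * u) = (l (e' * u) + l (s * u) * r (e' * u)) * F.
Proof.
have xE : e' * u = e' * si * (s * u) by rewrite -!mulrA (mulrA si) sis mul1r.
have Fsu : F * D (s * u) = l (s * u) * r (s * u) * F.
  rewrite !fps_mapM mulrA Fs -mulrA twist_coprod_u !mulrA; congr (_ * _).
  by rewrite -!mulrA; congr (_ * _); rewrite !mulrA lr.
rewrite {1}xE fps_mapM mulrA Fe -mulrA Fsu mulrA; congr (_ * _).
rewrite fps_map1 mul1r mulrDl; congr (_ + _).
  rewrite mulrA -(mulrA _ (r _)) lr mulrA -fps_mapM -xE -mulrA -fps_mapM.
  by rewrite -(mulrA si) (mulrA ui) uis -(mulrA s) uui mulr1 sis fps_map1 mulr1.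
by rewrite mulrA lr -mulrA -fps_mapM -xE.
Qed.
End SigmaCoproduct.

Section Cocycle.
Variables (K : fieldType) (U V W : algType K).
Variables (lf rf df : {lrmorphism U -> V}) (f1 f2 f3 : {lrmorphism U -> W}).
Variables (J M N O : {lrmorphism V -> W}).
Local Notation l := (fps_map lf).
Local Notation r := (fps_map rf).
Local Notation D := (fps_map df).
Local Notation i1 := (fps_map f1).
Local Notation i2 := (fps_map f2).
Local Notation i3 := (fps_map f3).
Hypothesis char0 : [pchar K] =i pred0.
Hypothesis f12 : forall x y, f2 y * f1 x = f1 x * f2 y.
Hypothesis f13 : forall x y, f3 y * f1 x = f1 x * f3 y.
Hypothesis f23 : forall x y, f3 y * f2 x = f2 x * f3 y.
Hypothesis f1N : forall x z, N z * f1 x = f1 x * N z.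
Hypotheses (Jl : forall x, J (lf x) = f1 x) (Jr : forall x, J (rf x) = f2 x).
Hypotheses (Ml : forall x, M (lf x) = J (df x)) (Mr : forall x, M (rf x) = f3 x).
Hypotheses (Nl : forall x, N (lf x) = f2 x) (Nr : forall x, N (rf x) = f3 x).
Hypotheses (Ol : forall x, O (lf x) = f1 x) (Or : forall x, O (rf x) = N (df x)).
Variables (h a x sigma : fps U) (t : K).
Hypothesis sigma0 : sigma 0 = 0.
Hypothesis ha : h * a = a * h + t *: a.
Hypothesis sigma_x : sigma * x = x * sigma.
Let v := fps_exp (t *: sigma).
Let F : fps V := fps_exp ('xi * (l a * r x)) * fps_exp (l h * r sigma).
Hypotheses (Dh : D h = l h + r h) (Da : D a = l a + r a).
Hypothesis Fx : F * D x = (l x + l v * r x) * F.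
Hypothesis Fsigma : F * D sigma = (l sigma * r 1 + l 1 * r sigma) * F.

(* With [J], [M], [N], [O] giving F_12, (Delta (x) id)(F), F_23, (id (x) Delta)(F):
   conjugation by F_23 turns (id (x) Delta)(F) into (id (x) Delta_F)(F). *)
Lemma cocycle : fps_map J F * fps_map M F = fps_map N F * fps_map O F.
Proof.
have mJl p : fps_map J (l p) = i1 p by apply: fps_map_comp.
have mJr p : fps_map J (r p) = i2 p by apply: fps_map_comp.
have mMl p : fps_map M (l p) = fps_map J (D p).
  by apply: fpsP => n /=.
have mMr p : fps_map M (r p) = i3 p by apply: fps_map_comp.
have mNl p : fps_map N (l p) = i2 p by apply: fps_map_comp.
have mNr p : fps_map N (r p) = i3 p by apply: fps_map_comp.
have mOl p : fps_map O (l p) = i1 p by apply: fps_map_comp.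
have mOr p : fps_map O (r p) = fps_map N (D p) by apply: fpsP => n /=.
have NC p w : fps_map N w * i1 p = i1 p * fps_map N w.
  by apply: fps_comm_coef => i j /=; rewrite f1N.
have NFx : fps_map N F * fps_map N (D x) = (i2 x + i2 v * i3 x) * fps_map N F.
  by rewrite -fps_mapM Fx fps_mapM fps_mapD mNl fps_mapM mNl mNr.
have NFs : fps_map N F * fps_map N (D sigma) = (i2 sigma + i3 sigma) * fps_map N F.
  by rewrite -fps_mapM Fsigma fps_mapM fps_mapD !fps_mapM !fps_map1 mulr1 mul1r mNl mNr.
have JF : fps_map J F = fps_exp ('xi * (i1 a * i2 x)) * fps_exp (i1 h * i2 sigma).
  by rewrite /F fps_mapM !fps_map_exp !fps_mapM fps_mapX !mJl !mJr.
have MF : fps_map M F =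
    fps_exp ('xi * ((i1 a + i2 a) * i3 x)) * fps_exp ((i1 h + i2 h) * i3 sigma).
  rewrite /F fps_mapM !fps_map_exp !fps_mapM fps_mapX !mMl !mMr Da Dh !fps_mapD.
  by rewrite !mJl !mJr.
have NF : fps_map N F = fps_exp ('xi * (i2 a * i3 x)) * fps_exp (i2 h * i3 sigma).
  by rewrite /F fps_mapM !fps_map_exp !fps_mapM fps_mapX !mNl !mNr.
have OF : fps_map O F = fps_exp ('xi * (i1 a * fps_map N (D x)))
    * fps_exp (i1 h * fps_map N (D sigma)).
  by rewrite /F fps_mapM !fps_map_exp !fps_mapM fps_mapX !mOl !mOr.
have core := cocycle_core char0 f12 f13 f23 sigma0 ha sigma_x.
rewrite JF MF core OF -NF [RHS]mulrA.
have s0 (f : {lrmorphism U -> W}) : fps_map f sigma 0 = 0 by rewrite /= sigma0 rmorph0.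
have NDs0 : fps_map N (D sigma) 0 = 0 by rewrite /= sigma0 !rmorph0.
have X0 (p : fps W) : ('xi * p) 0 = 0 by rewrite fps_coefXM.
have -> : fps_map N F * fps_exp ('xi * (i1 a * fps_map N (D x))) =
          fps_exp ('xi * (i1 a * (i2 x + i2 v * i3 x))) * fps_map N F.
  symmetry; apply: fps_exp_intertwine => //.
  by rewrite -!mulrA -NFx (mulrA (i1 a)) -NC -mulrA [LHS]mulrA -fps_XC -mulrA.
rewrite -[LHS]mulrA -[RHS]mulrA; congr (_ * _); apply: fps_exp_intertwine.
- by rewrite fps_coef0M fps_coefD !s0 addr0 mulr0.
- by rewrite fps_coef0M NDs0 mulr0.
by rewrite -mulrA -NFs mulrA -NC mulrA.
Qed.
End Cocycle.

Lemma fpsC_three_halves (K : fieldType) (A : algType K) (x : A) :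
  [pchar K] =i pred0 -> fpsC x = (3 / 2) *: fpsC ((2 / 3) *: x).
Proof.
move=> char0; rewrite fpsCZ scalerA (_ : 3 / 2 * (2 / 3) = 1) ?scale1r //.
by field; rewrite !((pcharf0P K).1 char0).
Qed.

Lemma fps_map_aug_in (K : fieldType) (L : lieAlgType K) (A : augAlgType K) (x : L) :
  fps_map (@aug_in K (env L) A) (fps_in x) = 0.
Proof.
have E : aug_in A (env_in x) = 0 by rewrite /aug_in (counit_in x) scale0r.
by rewrite /fps_in fps_mapC -[RHS]fpsC0; apply: congr1; exact: E.
Qed.

(** * The twist of U(sl(3)), with [sigma] and its exponentials given by their equations *)

Section SpecialLinearTwist.
Variables (K : fieldType) (gamma : K).
Hypothesis char0 : [pchar K] =i pred0.
Local Notation sl3 := (sl K 3).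
Local Notation U := (env sl3).
Local Notation V := (tens U U).
Local Notation l := (fps_map (tens_inl U : U -> V)).
Local Notation r := (fps_map (tens_inr U : U -> V)).
Let h := fps_in (h13 + gamma *: hperp : sl3).
Let k := fps_in ((2 / 3) *: hperp : sl3).
Let c := 2^-1 * (3 * gamma - 1).
Let a := fps_in (e12 : sl3).
Let b := fps_in (e21 : sl3).
Let g := fps_in (e32 : sl3).
Let e' := fps_in (e23 : sl3).
Let e := fps_in (e13 : sl3).
Let hp := fps_in (hperp : sl3).
Variable sigma : fps U.
Hypothesis sigma0 : sigma 0 = 0.
Hypothesis sigmaE : fps_exp sigma = 1 + 'xi * e.
Hypothesis sigma_comm : forall x z,
  x * env_in e13 = env_in e13 * x + z -> z * env_in e13 = env_in e13 * z ->
  fpsC x * sigma = sigma * fpsC x + fps_exp (- sigma) * ('xi * fpsC z).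
Hypothesis sigma_aug : fps_map (aug_in U) sigma = 0.
Variables u ui s si w : fps U.
Hypothesis uE : fps_exp (c *: sigma) = u.
Hypothesis uiE : fps_exp (- (c *: sigma)) = ui.
Hypothesis sE : fps_exp sigma = s.
Hypothesis siE : fps_exp (- sigma) = si.
Hypothesis wE : w = si * ui.

Let P : fps V := fps_exp (l h * r sigma).
Let Q : fps V := fps_exp ('xi * (l a * r (e' * u))).
Let F := Q * P.

Let LRC (x z : U) : tens_inr U z * tens_inl U x = tens_inl U x * tens_inr U z.
Proof. by rewrite tens_inlrC. Qed.

Let br := env_sl3_brackets gamma char0.
Let yE : 'xi * fpsC (env_in (e23 : sl3)) = 'xi * e'. Proof. by []. Qed.

Let TR : tensor_rels c%:A 'xi (l u) (l ui) (l s) (l si) (l ('xi * e'))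
    (l a) (l k) (l h) (l b) (l g) (r u) (r ui) (r s) (r si) (r ('xi * e'))
    (r a) (r k) (r h) (r b) (r g).
Proof. exact: (fps_tensor_relsP char0 LRC br sigma0 sigmaE sigma_comm uE uiE sE siE yE). Qed.

Let PR : jordanian_rels c%:A 'xi (l s) (l ('xi * e'))
    (l a) (l k) (l h) (l b) (l g) (r u) (r ui) (r s) (r si) (r ('xi * e'))
    (r a) (r k) (r h) (r b) (r g) P.
Proof. exact: (fps_jordanian_relsP char0 LRC br sigma0 sigmaE sigma_comm uE uiE sE siE yE). Qed.

Let qE : l a * r ('xi * e') * r u = 'xi * (l a * r (e' * u)).
Proof.
by rewrite (fps_mapM (tens_inr U) 'xi) fps_mapX (fps_mapM (tens_inr U) e') !mulrA (fps_XC (l a)).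
Qed.

Let QR : extension_rels c%:A 'xi (l s) (l ('xi * e'))
    (l a) (l k) (l h) (l b) (l g) (r u) (r ui) (r s) (r si) (r ('xi * e'))
    (r a) (r k) (r h) (r b) (r g) Q.
Proof.
rewrite /Q -qE.
exact: (fps_extension_relsP char0 LRC br sigma0 sigmaE sigma_comm uE uiE sE siE yE).
Qed.

Local Notation D := (fps_map (coprod sl3)).
Let Din (x : sl3) : D (fps_in x) = l (fps_in x) + r (fps_in x).
Proof. by rewrite /fps_in !fps_mapC coprod_in fpsCD. Qed.

Let p0 : (l h * r sigma) 0 = 0.
Proof. by rewrite fps_coef0M /= sigma0 rmorph0 mulr0. Qed.
Let q0 : ('xi * (l a * r (e' * u))) 0 = 0.
Proof. by rewrite fps_coefXM. Qed.

Let G : fps V := fps_exp (- (l h * r sigma)) * fps_exp (- ('xi * (l a * r (e' * u)))).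
Let FG : F * G = 1.
Proof. exact: mul_inverse (fps_expNr char0 p0) (fps_expNr char0 q0). Qed.
Let GF : G * F = 1.
Proof. exact: mul_inverse (fps_expNl char0 q0) (fps_expNl char0 p0). Qed.

Let sis : si * s = 1. Proof. by rewrite -siE -sE; apply: fps_expNl. Qed.
Let ssi : s * si = 1. Proof. by rewrite -siE -sE; apply: fps_expNr. Qed.
Let uui : ui * u = 1.
Proof. by rewrite -uiE -uE; apply: fps_expNl => //; apply: fps_coefZ0. Qed.
Let uis : ui * s = s * ui.
Proof.
have [_ [_ [_ [_ [_ [E _]]]]]] := exp_inverse_relsP c char0 sigma0.
by rewrite -uiE -sE; apply: esym; exact: E.
Qed.

Let hpE : hp = (3 / 2) *: k.
Proof.
by rewrite /hp /k /fps_in env_inZ; apply: fpsC_three_halves.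
Qed.

Let sX : s = 1 + 'xi * e. Proof. by rewrite -sE. Qed.

Let Fs := twist_coprod_s (df := coprod sl3) TR PR QR (Din e13) sX.
Let Fsigma := twist_coprod_sigma char0 LRC FG GF sigma0 sE Fs.
Let Fe := twist_coprod_e23 LRC TR PR QR (Din e23) (Din e13) sX sis ssi.

Let Fx := twist_coprod_x char0 LRC FG GF sigma0 uE sE Fs sis uui uis Fe.

Local Notation W := (tens V U).
Let f1 : {lrmorphism U -> W} := tens_inl U \o tens_inl U.
Let f2 : {lrmorphism U -> W} := tens_inl U \o tens_inr U.
Let f3 : {lrmorphism U -> W} := tens_inr V.
Let J : {lrmorphism V -> W} := tens_inl U.
Let M : {lrmorphism V -> W} := tens_map (coprod sl3) idfun.
(** Composing with [tens_assoc] brings [F_23], and likewise [(id (x) Delta)(F)], into the same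
    target as the left side of the cocycle equation. *)
Let N : {lrmorphism V -> W} := @tens_assoc K U U U \o tens_inr U.
Let O : {lrmorphism V -> W} := @tens_assoc K U U U \o tens_map idfun (coprod sl3).

Let f12 (x z : U) : f2 z * f1 x = f1 x * f2 z.
Proof. by rewrite /f1 /f2 /= -!(rmorphM (tens_inl U)) LRC. Qed.
Let f13 (x z : U) : f3 z * f1 x = f1 x * f3 z.
Proof. by rewrite /f1 /f3 /= tens_inlrC. Qed.
Let f23 (x z : U) : f3 z * f2 x = f2 x * f3 z.
Proof. by rewrite /f2 /f3 /= tens_inlrC. Qed.

Let assoc_inl (x : U) : @tens_assoc K U U U (tens_inl V x) = f1 x.
Proof. by rewrite /tens_inl -tmul11 tens_assocE. Qed.
Let assoc_inr (x z : U) : @tens_assoc K U U U (tens_inr U (tmul x z)) = tmul (tmul 1 x) z.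
Proof. exact: tens_assocE. Qed.

Let f1N (x : U) (z : V) : N z * f1 x = f1 x * N z.
Proof. by rewrite -assoc_inl /N /= -!(rmorphM (@tens_assoc K U U U)) tens_inlrC. Qed.

Let Jl (x : U) : J (tens_inl U x) = f1 x. Proof. by []. Qed.
Let Jr (x : U) : J (tens_inr U x) = f2 x. Proof. by []. Qed.
Let Ml (x : U) : M (tens_inl U x) = J (coprod sl3 x).
Proof. exact: tens_mapE. Qed.
Let Mr (x : U) : M (tens_inr U x) = f3 x.
Proof. by rewrite /M /tens_inr tens_mapE rmorph1. Qed.
Let Nl (x : U) : N (tens_inl U x) = f2 x. Proof. exact: assoc_inr. Qed.
Let Nr (x : U) : N (tens_inr U x) = f3 x.
Proof. by rewrite /N /= assoc_inr tmul11. Qed.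
Let Ol (x : U) : O (tens_inl U x) = f1 x.
Proof.
have E : tens_map idfun (coprod sl3) (tens_inl U x) = tens_inl V x.
  by rewrite /tens_inl tens_mapE rmorph1.
by rewrite /O /= E assoc_inl.
Qed.
Let Or (x : U) : O (tens_inr U x) = N (coprod sl3 x).
Proof.
have E : tens_map idfun (coprod sl3) (tens_inr U x) = tens_inr U (coprod sl3 x).
  by rewrite /tens_inr tens_mapE.
by rewrite /O /N /= E.
Qed.

Let ha : h * a = a * h + (1 + c) *: a.
Proof.
case: br => _ _ [_ _ ha] _ _.
by rewrite /h /a /fps_in -!fpsCM ha fpsCD fpsCZ addrC [c + 1]addrC addrC.
Qed.

Let sigma_x : sigma * (e' * u) = e' * u * sigma.
Proof.
have us : u * sigma = sigma * u.
  rewrite -uE; apply: fps_exp_comm; first exact: fps_coefZ0.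
  by rewrite -scalerAl -scalerAr.
case: br => _ [e23e _ _ _] _ _ _.
have es : e' * sigma = sigma * e'.
  rewrite /e' /fps_in (@sigma_comm _ 0) ?addr0 ?mul0r ?mulr0 //.
  by rewrite fpsC0 !mulr0 addr0.
by rewrite -[RHS]mulrA us !mulrA es.
Qed.

Let Fx' : F * D (e' * u) =
  (l (e' * u) + l (fps_exp ((1 + c) *: sigma)) * r (e' * u)) * F.
Proof. by rewrite (fps_expZD _ _ _ sigma0) // scale1r sE uE; apply: Fx. Qed.

Let cocycleF : fps_map J F * fps_map M F = fps_map N F * fps_map O F.
Proof.
exact: (cocycle char0 f12 f13 f23 f1N Jl Jr Ml Mr Nl Nr Ol Or sigma0 ha sigma_x
  (Din _) (Din _) Fx' Fsigma).
Qed.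

Let aug_in0 (x : sl3) : fps_map (@aug_in K U U) (fps_in x) = 0.
Proof. exact: fps_map_aug_in. Qed.

Let augml_l p : fps_map (@tens_augml K U U) (l p) = fps_map (@aug_in K U U) p.
Proof. by apply: fps_map_comp => x; rewrite tens_augmlE. Qed.

Let augmr_r p : fps_map (@tens_augmr K U U) (r p) = fps_map (@aug_in K U U) p.
Proof. by apply: fps_map_comp => x; rewrite tens_augmrE. Qed.

(** For the counit conditions, [eps (x) id] kills the left factors [e12] and [h], while [id (x) eps]
    kills the right factors [e23 e^(c sigma)] and [sigma]. *)
Lemma sl3_is_twist : is_twist F.
Proof.
split.
- exists G; exact: conj FG GF.
- apply: (etrans cocycleF).
  exact: (esym (fps_mapM (@tens_assoc K U U U) (fps_map (tens_inr U) F)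
    (fps_map (tens_map idfun (coprod sl3)) F))).
- apply: fps_map_exp_mul_eq1; left; apply: etrans (augml_l _) (aug_in0 _).
- apply: fps_map_exp_mul_eq1; right; last by apply: etrans (augmr_r _) sigma_aug.
  apply: etrans (augmr_r _) _; rewrite (fps_mapM (@aug_in K U U) e').
  by rewrite [X in X * _]aug_in0 mul0r.
Qed.

Lemma sl3_twisted_h :
  twisted_coprod F h = h \ox si + 1 \ox h - 'xi * (a \ox (e' * si * u)).
Proof.
apply: (twisted_coprodP FG GF); rewrite !fps_tmulE.
exact: (twist_coprod_h TR PR QR (Din _)).
Qed.
Lemma sl3_twisted_sigma : twisted_coprod F sigma = sigma \ox 1 + 1 \ox sigma.
Proof. apply: (twisted_coprodP FG GF); rewrite !fps_tmulE; exact: Fsigma. Qed.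

Lemma sl3_twisted_e12 : twisted_coprod F a = a \ox u + 1 \ox a.
Proof.
apply: (twisted_coprodP FG GF); rewrite !fps_tmulE.
exact: (twist_coprod_a TR PR QR (Din _)).
Qed.

Lemma sl3_twisted_e23 :
  twisted_coprod F (e' * si) = (e' * si) \ox w + 1 \ox (e' * si).
Proof. apply: (twisted_coprodP FG GF); rewrite !fps_tmulE wE; exact: Fe. Qed.

Lemma sl3_twisted_hperp : twisted_coprod F hp = hp \ox 1 + 1 \ox hp.
Proof.
apply: (twisted_coprodP FG GF); rewrite !fps_tmulE.
exact: (twist_coprod_hp TR PR QR (Din _) hpE).
Qed.

Lemma sl3_twisted_e21 : twisted_coprod F b =
  b \ox w + 1 \ox b + (1 - gamma) *: ('xi * (hp \ox (e' * si))).
Proof.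
apply: (twisted_coprodP FG GF); rewrite !fps_tmulE wE.
exact: (twist_coprod_b char0 TR PR QR (Din _) hpE).
Qed.

Lemma sl3_twisted_e32 : twisted_coprod F (g - 'xi * (h * a)) =
  (g - 'xi * (h * a)) \ox u + 1 \ox (g - 'xi * (h * a))
  - (gamma + 1) *: ('xi * (a \ox (hp * u))).
Proof.
apply: (twisted_coprodP FG GF); rewrite !fps_tmulE.
exact: (twist_coprod_g char0 TR PR QR (Din _) (Din _) (Din _) hpE).
Qed.

Let e31E : fps_in e31 = g * b - b * g.
Proof. by rewrite /g /b /fps_in -!fpsCM -fpsCN -fpsCD (env_in_e31 K). Qed.

Lemma sl3_twisted_e31 : let f := fps_in e31 - 'xi * h ^+ 2 in
  twisted_coprod F f = f \ox si + 1 \ox f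
   + 'xi * (a \ox (b * u))
   - 'xi * ((g - 'xi * (h * a)) \ox (e' * si * u))
   - (2 * gamma) *: ('xi * (h \ox (hp * si)))
   + (2 * gamma) *: ('xi ^+ 2 * (a \ox (hp * (e' * si) * u))).
Proof.
cbv zeta; rewrite e31E; apply: (twisted_coprodP FG GF); rewrite !fps_tmulE.
exact: (twist_coprod_f char0 TR PR QR (Din _) (Din _) (Din _) hpE).
Qed.

Lemma sl3_twist_solution :
  let F' := fps_exp ('xi * (a \ox (e' * u))) * fps_exp (h \ox sigma) in
  let e23' := e' * si in
  let e32' := g - 'xi * (h * a) in
  let e31' := fps_in e31 - 'xi * h ^+ 2 in
  is_twist F' /\
  twisted_coprod F' h = h \ox si + 1 \ox h - 'xi * (a \ox (e23' * u)) /\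
  twisted_coprod F' sigma = sigma \ox 1 + 1 \ox sigma /\
  twisted_coprod F' a = a \ox u + 1 \ox a /\
  twisted_coprod F' e23' = e23' \ox w + 1 \ox e23' /\
  twisted_coprod F' hp = hp \ox 1 + 1 \ox hp /\
  twisted_coprod F' b =
    b \ox w + 1 \ox b + (1 - gamma) *: ('xi * (hp \ox e23')) /\
  twisted_coprod F' e32' =
    e32' \ox u + 1 \ox e32' - (gamma + 1) *: ('xi * (a \ox (hp * u))) /\
  twisted_coprod F' e31' = e31' \ox si + 1 \ox e31'
    + 'xi * (a \ox (b * u)) - 'xi * (e32' \ox (e23' * u))
    - (2 * gamma) *: ('xi * (h \ox (hp * si)))
    + (2 * gamma) *: ('xi ^+ 2 * (a \ox (hp * e23' * u))).
Proof.
move=> F'; have -> : F' = F by rewrite /F' (fps_tmulE a) (fps_tmulE h).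
exact: (conj sl3_is_twist (conj sl3_twisted_h (conj sl3_twisted_sigma
  (conj sl3_twisted_e12 (conj sl3_twisted_e23 (conj sl3_twisted_hperp
  (conj sl3_twisted_e21 (conj sl3_twisted_e32 sl3_twisted_e31)))))))).
Qed.

End SpecialLinearTwist.

(** Characteristic 0 supplies the inverses of 2 and 3, of the factorials in the exponential and of
    the denominators in the logarithm. *)
Lemma sl3_twist_field (K : fieldType) (gamma : K) : [pchar K] =i pred0 ->
  let h := fps_in (h13 + gamma *: hperp) in
  let sigma := fps_ln (1 + 'xi * fps_in (@e13 K)) in
  let c := 2^-1 * (3 * gamma - 1) in
  let d := - (2^-1 * (3 * gamma + 1)) in
  let F :=
    fps_exp ('xi * (fps_in e12 \ox (fps_in e23 * fps_exp (c *: sigma)))) *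
    fps_exp (h \ox sigma) in
  let h' := h in
  let hp' := fps_in hperp in
  let e12' := fps_in e12 in
  let e21' := fps_in e21 in
  let e13' := sigma in
  let e23' := fps_in e23 * fps_exp (- sigma) in
  let e32' := fps_in e32 - 'xi * (h * fps_in e12) in
  let e31' := fps_in e31 - 'xi * h ^+ 2 in
  is_twist F /\
  twisted_coprod F h' =
    h' \ox fps_exp (- e13') + 1 \ox h'
    - 'xi * (e12' \ox (e23' * fps_exp (c *: e13'))) /\
  twisted_coprod F e13' = e13' \ox 1 + 1 \ox e13' /\
  twisted_coprod F e12' = e12' \ox fps_exp (c *: e13') + 1 \ox e12' /\
  twisted_coprod F e23' = e23' \ox fps_exp (d *: e13') + 1 \ox e23' /\
  twisted_coprod F hp' = hp' \ox 1 + 1 \ox hp' /\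
  twisted_coprod F e21' =
    e21' \ox fps_exp (d *: e13') + 1 \ox e21'
    + (1 - gamma) *: ('xi * (hp' \ox e23')) /\
  twisted_coprod F e32' =
    e32' \ox fps_exp (c *: e13') + 1 \ox e32'
    - (gamma + 1) *: ('xi * (e12' \ox (hp' * fps_exp (c *: e13')))) /\
  twisted_coprod F e31' =
    e31' \ox fps_exp (- e13') + 1 \ox e31'
    + 'xi * (e12' \ox (e21' * fps_exp (c *: e13')))
    - 'xi * (e32' \ox (e23' * fps_exp (c *: e13')))
    - (2 * gamma) *: ('xi * (h' \ox (hp' * fps_exp (- e13'))))
    + (2 * gamma) *:
        ('xi ^+ 2 * (e12' \ox (hp' * e23' * fps_exp (c *: e13')))).
Proof.
move=> char0; cbv zeta.
set sigma := fps_ln _.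
have sigma0 : sigma 0%N = 0 by apply: fps_ln0.
have sigmaE : fps_exp sigma = 1 + 'xi * fps_in e13 by apply: fps_exp_ln.
have sigma_comm := @fps_ln_comm _ _ char0 (env_in (@e13 K)).
(* The counit sends [1 + xi e13] to 1, whose logarithm is 0. *)
have sigma_aug : fps_map (aug_in (env (sl K 3))) sigma = 0.
  have E : fps_map (aug_in (env (sl K 3))) (1 + 'xi * fps_in e13) = 1.
    rewrite (fps_mapD (aug_in (env (sl K 3)))) fps_map1 fps_mapM.
    by rewrite [X in _ * X]fps_map_aug_in mulr0 addr0.
  apply: etrans (fps_map_ln (aug_in (env (sl K 3))) _) _.
  by apply: etrans (congr1 _ E) (fps_ln1 _).
(* The exponent [- (3 gamma + 1) / 2] is [-1 - c], so this exponential is the product [si * ui] in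
   which the computations were made. *)
have wE : fps_exp (- (2^-1 * (3 * gamma + 1)) *: sigma) =
    fps_exp (- sigma) * fps_exp (- ((2^-1 * (3 * gamma - 1)) *: sigma)).
  rewrite -scaleNr -[in - sigma]scaleN1r -(fps_expZD char0 _ _ sigma0).
  have n2 : (2 : K) != 0 by rewrite ((pcharf0P K).1 char0).
  by have -> : - (2^-1 * (3 * gamma + 1)) = -1 - 2^-1 * (3 * gamma - 1) by field.
exact: (sl3_twist_solution char0 sigma0 sigmaE sigma_comm sigma_aug erefl erefl erefl erefl wE).
Qed.

Theorem mainTheorem2 (R : realType) (gamma : R[i]) :
  let h := fps_in (h13 + gamma *: hperp) in
  let sigma := fps_ln (1 + 'xi * fps_in (@e13 R[i])) in
  let c := 2^-1 * (3 * gamma - 1) in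
  let d := - (2^-1 * (3 * gamma + 1)) in
  let F :=
    fps_exp ('xi * (fps_in e12 \ox (fps_in e23 * fps_exp (c *: sigma)))) *
    fps_exp (h \ox sigma) in
  let h' := h in
  let hp' := fps_in hperp in
  let e12' := fps_in e12 in
  let e21' := fps_in e21 in
  let e13' := sigma in
  let e23' := fps_in e23 * fps_exp (- sigma) in
  let e32' := fps_in e32 - 'xi * (h * fps_in e12) in
  let e31' := fps_in e31 - 'xi * h ^+ 2 in
  is_twist F /\
  twisted_coprod F h' =
    h' \ox fps_exp (- e13') + 1 \ox h'
    - 'xi * (e12' \ox (e23' * fps_exp (c *: e13'))) /\
  twisted_coprod F e13' = e13' \ox 1 + 1 \ox e13' /\
  twisted_coprod F e12' = e12' \ox fps_exp (c *: e13') + 1 \ox e12' /\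
  twisted_coprod F e23' = e23' \ox fps_exp (d *: e13') + 1 \ox e23' /\
  twisted_coprod F hp' = hp' \ox 1 + 1 \ox hp' /\
  twisted_coprod F e21' =
    e21' \ox fps_exp (d *: e13') + 1 \ox e21'
    + (1 - gamma) *: ('xi * (hp' \ox e23')) /\
  twisted_coprod F e32' =
    e32' \ox fps_exp (c *: e13') + 1 \ox e32'
    - (gamma + 1) *: ('xi * (e12' \ox (hp' * fps_exp (c *: e13')))) /\
  twisted_coprod F e31' =
    e31' \ox fps_exp (- e13') + 1 \ox e31'
    + 'xi * (e12' \ox (e21' * fps_exp (c *: e13')))
    - 'xi * (e32' \ox (e23' * fps_exp (c *: e13')))
    - (2 * gamma) *: ('xi * (h' \ox (hp' * fps_exp (- e13'))))
    + (2 * gamma) *: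
        ('xi ^+ 2 * (e12' \ox (hp' * e23' * fps_exp (c *: e13')))).
Proof. exact: sl3_twist_field (Num.Theory.pchar_num _). Qed.
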